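(* For $1 \le n \le 170$, the value $q(n)$ is as follows: $q(n)=n$ for $n\in[1,4]$; $q(n)=5$ for $n\in[5,6]$; $q(n)=6$ for $n\in[7,8]$; $q(n)=7$ for $n\in[9,10]$; $q(n)=8$ for $n\in[11,12]$; $q(n)=9$ for $n\in[13,15]$; $q(n)=10$ for $n\in[16,20]$; $q(n)=11$ for $n\in[21,25]$; $q(n)=12$ for $n\in[26,30]$; $q(n)=13$ for $n\in[31,35]$; $q(n)=14$ for $n\in[36,44]$; $q(n)=15$ for $n\in[45,55]$; $q(n)=16$ for $n\in[56,66]$; $q(n)=17$ for $n\in[67,80]$; $q(n)=18$ for $n\in[81,96]$; $q(n)=19$ for $n\in[97,115]$; $q(n)=20$ for $n\in[116,138]$; $q(n)=21$ for $n\in[139,170]$. For every integer $n \ge 171$, $q(n) = \max\{\, q_r(n) \mid 0 \le r \le 5 \,\}$, where \begin{align*} q_0(n) &= 6\left\lfloor\frac16\left\lceil 6\log_3\left( \frac{2n}{55} + \frac1{11} \right) + 11 \right\rceil\right\rfloor\\ q_1(n) &= 6\left\lfloor\frac16\left\lceil 6\log_3\left( \frac{n}{33} + \frac1{11} \right) + 11 \right\rceil\right\rfloor + 1\\ q_2(n) &= 6\left\lfloor\frac16\left\lceil 6\log_3\left( \frac{2n}{235} + \frac1{47} \right) + 17 \right\rceil\right\rfloor + 2\\ q_3(n) &= 6\left\lfloor\frac16\left\lceil 6\log_3\left( \frac{n}{141} + \frac1{47} \right) + 17 \right\rceil\right\rfloor + 3\\ q_4(n) &= 6\left\lfloor\frac16\left\lceil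 6\log_3\left( \frac{2n}{115} + \frac1{23} \right) + 11 \right\rceil\right\rfloor + 4\\ q_5(n) &= 6\left\lfloor\frac16\left\lceil 6\log_3\left( \frac{n}{69} + \frac1{23} \right) + 11 \right\rceil\right\rfloor + 5. \end{align*}
   Context: For a family $\mathcal{S}$ of disjoint line segments in the plane, an alternating path among $\mathcal{S}$ is a simple polygonal chain in which every other segment is in $\mathcal{S}$. An alternating path among $\mathcal{S}$ is compatible with $\mathcal{S}$ if the chain does not cross any segment in $\mathcal{S}$ that is not in the chain. For $n \ge 1$, $q(n)$ is the maximum number $k$ such that any family $\mathcal{S}$ of $n$ disjoint segments in the plane, whose $2n$ endpoints are in convex position, admits an alternating path compatible with $\mathcal{S}$ going through $k$ segments in $\mathcal{S}$. Intervals $[a,b]$ denote sets of integers $n$ with $a\le n\le b$. *)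

(* Defs.v *)
From mathcomp Require Import all_boot all_order all_algebra.
From mathcomp Require Import all_classical all_reals all_analysis.

Set Implicit Arguments.
Unset Strict Implicit.
Unset Printing Implicit Defensive.

Import Order.TTheory GRing.Theory Num.Theory.

Local Open Scope classical_set_scope.
Local Open Scope ring_scope.

Section Plane.
Context {R : realType}.
Local Notation point := 'rV[R]_2.
Implicit Types (a b c d : point) (p : seq point).

Definition segment a b : set point :=
  [set (1 - t) *: a + t *: b | t in `[0, 1]%classic].

Definition open_segment a b : set point :=
  [set (1 - t) *: a + t *: b | t in `]0, 1[%classic].

Definition convex_hull (A : set point) : set point :=
  smallest (@convex_set R point) A.

(* Every point is a vertex of the convex hull of the family; in particular
   the points are pairwise distinct and no three of them are collinear. *)
Definition convex_position (I : Type) (P : I -> point) : Prop :=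
  forall i, ~ convex_hull [set P j | j in [set j | j <> i]] (P i).

Definition chain_edge p (i : nat) : set point := segment p`_i p`_i.+1.

(* The polygonal chain with successive vertices p; its edges have indices
   i with i.+1 < size p. *)
Definition simple_chain p : Prop :=
  [/\ (1 < size p)%N,
      forall i, (i.+1 < size p)%N -> p`_i <> p`_i.+1,
      forall i, (i.+2 < size p)%N ->
        chain_edge p i `&` chain_edge p i.+1 = [set p`_i.+1]
    & forall i j, (i.+1 < j)%N -> (j.+1 < size p)%N ->
        chain_edge p i `&` chain_edge p j = set0].

Section Family.
Context {n : nat}.
Implicit Type S : 'I_n -> point * point.

Definition fam_segment S (j : 'I_n) : set point := segment (S j).1 (S j).2.

Definition endpoint S (e : 'I_n * bool) : point :=
  if e.2 then (S e.1).2 else (S e.1).1.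

(* Convex position of the 2n endpoints makes the segments nondegenerate. *)
Definition convex_disjoint_family S : Prop :=
  trivIset setT (fam_segment S) /\ convex_position (endpoint S).

Definition in_chain S p (j : 'I_n) : Prop :=
  exists2 i, (i.+1 < size p)%N & chain_edge p i = fam_segment S j.

(* Either the even-indexed or the odd-indexed edges are those in S, so the
   first and the last edge of the chain may or may not be in S. *)
Definition alternating_path S p : Prop :=
  simple_chain p /\
  exists b : bool, forall i, (i.+1 < size p)%N ->
    (exists j, chain_edge p i = fam_segment S j) <-> odd i = b.

(* Two segments cross when they have a common relative interior point. *)
Definition compatible S p : Prop :=
  forall j, ~ in_chain S p j ->
  forall i, (i.+1 < size p)%N ->
    open_segment p`_i p`_i.+1 `&` open_segment (S j).1 (S j).2 = set0.

Definition num_segments S p : nat := #|[pred j | `[< in_chain S p j >]]|.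

End Family.
End Plane.

Definition always_admits (R : realType) (n k : nat) : Prop :=
  forall S : 'I_n -> 'rV[R]_2 * 'rV[R]_2, convex_disjoint_family S ->
  exists p, [/\ alternating_path S p, compatible S p & num_segments S p = k].

(* "q(n) = k": the maximum exists and equals k. *)
Definition q_is (R : realType) (n k : nat) : Prop :=
  always_admits R n k /\ forall k', always_admits R n k' -> (k' <= k)%N.

Section Formulas.
Context (R : realType).

Definition log3 (x : R) : R := ln x / ln 3.

Definition sixfloor (x : R) : int :=
  6 * Num.floor (6^-1 * (Num.ceil x)%:~R : R).

Definition q0 (n : nat) : int :=
  sixfloor (6 * log3 (2 * n%:R / 55 + 1 / 11) + 11).
Definition q1 (n : nat) : int :=
  sixfloor (6 * log3 (n%:R / 33 + 1 / 11) + 11) + 1.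
Definition q2 (n : nat) : int :=
  sixfloor (6 * log3 (2 * n%:R / 235 + 1 / 47) + 17) + 2.
Definition q3 (n : nat) : int :=
  sixfloor (6 * log3 (n%:R / 141 + 1 / 47) + 17) + 3.
Definition q4 (n : nat) : int :=
  sixfloor (6 * log3 (2 * n%:R / 115 + 1 / 23) + 11) + 4.
Definition q5 (n : nat) : int :=
  sixfloor (6 * log3 (n%:R / 69 + 1 / 23) + 11) + 5.

End Formulas.

(* Main.v *)
Require Import Defs.
From mathcomp Require Import all_boot all_order all_algebra.
From mathcomp Require Import all_classical all_reals all_analysis.
From mathcomp Require Import zify ring lra.

(** The [n] disjoint segments form a noncrossing perfect matching of [2n] points
    on a convex curve; its dual graph is a plane tree with [n] edges whose
    vertices are the regions.  A link of a compatible alternating path stays in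
    one region, so the sequence of segments of the path follows a path of the
    tree and visits only edges incident to it; conversely, inside a region all
    incident segments can be used up from both ends before leaving through a
    prescribed one.  Hence [q n] is the minimum over all trees with [n] edges of
    the maximal number of edges incident to a path.  Rooting a tree at its
    centre, the extremal trees are balanced with root degree at most 6 and,
    mostly, three children below, which makes their size grow by a factor 3
    whenever the path grows by 6. *)

(** The proof works with the inverse function: [max_family k] is the largest [n] with value at most
    [k], so the value at [n] is the [k] with [max_family k.-1 < n <= max_family k]. A root of degree
    [d] whose branches all have height [w] yields paths with [2 * w + d - 2] edges, two branches and
    the remaining root edges. This bound on paths holds for every choice of root; the centre is
    needed only for the converse, to turn a large size into a long path. The constants of the
    formula come from [max_tree h.+3 = (3 * max_tree h).+1], valid for [6 <= h]: then
    [2 * max_tree h + 1] is geometric along each class of [h] modulo 3, with values 23, 33 = 3 * 11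
    and 47 at [h] = 6, 7, 8. Three classes of heights and the two root degrees 5 and 6 that are
    optimal for large [k] make the six residues modulo 6. For small values, two children or root
    degrees 3 and 4 can win, hence the table. *)

Set Implicit Arguments.
Unset Strict Implicit.
Unset Printing Implicit Defensive.

(** * Extremal sizes *)

(* The largest size of a tree, planted at an edge, in which at most [h] edges
   are incident to any path going down from that edge: giving the top vertex
   two or three children is optimal. *)
Fixpoint max_tree (h : nat) : nat :=
  match h with
  | 0 => 0
  | 1 => 1
  | 2 => 2
  | ((h'.+1) as h1).+2 => (maxn (2 * max_tree h1) (3 * max_tree h')).+1
  end.

Lemma max_treeSSS h :
  max_tree h.+3 = (maxn (2 * max_tree h.+1) (3 * max_tree h)).+1.
Proof. by []. Qed.

Arguments max_tree : simpl never.

Lemma ind3 (P : nat -> Prop) m :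
  P m -> P m.+1 -> P m.+2 ->
  (forall h, m <= h -> P h -> P h.+1 -> P h.+3) -> forall h, m <= h -> P h.
Proof.
move=> P0 P1 P2 PS h; elim/ltn_ind: h => h IH mh.
case: (ltnP h m.+3) => [|h3].
  rewrite ltnS leq_eqVlt => /predU1P[-> //|]; rewrite ltnS leq_eqVlt.
  by case/predU1P => [-> //|?]; rewrite (_ : h = m) //; lia.
have -> : h = (h - 3).+3 by lia.
by apply: PS; [lia| |]; apply: IH; lia.
Qed.

(** This makes three children at least as good as two. The threshold is sharp: at [h = 5] it would
    read 22 <= 21. *)
Lemma max_tree_ratio32 h : 6 <= h -> 2 * max_tree h.+1 <= 3 * max_tree h.
Proof.
apply: (@ind3 (fun h => 2 * max_tree h.+1 <= 3 * max_tree h)) => // {}h _ H0 H1.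
by rewrite !max_treeSSS; lia.
Qed.

Lemma max_tree_rec h : 6 <= h -> max_tree h.+3 = (3 * max_tree h).+1.
Proof. by move/max_tree_ratio32; rewrite max_treeSSS; lia. Qed.

(** The ratio 7/5 serves two exchanges: trading [d] branches for [d - 1] branches one level higher
    loses nothing for [4 <= d], and trading them for [d - 2] such branches loses nothing for
    [7 <= d]. Equality holds at [h = 4]. *)
Lemma max_tree_ratio75 h : 7 * max_tree h <= 5 * max_tree h.+1.
Proof.
case: (ltnP h 6) => [|/= h6]; first by do 6![case: h => [//|h]].
(* The extra 1 makes the inequality reproduce itself when both sizes go from [m] to [3 * m + 1]. *)
suff: 7 * max_tree h + 1 <= 5 * max_tree h.+1 by lia.
move: h h6; apply: (@ind3 (fun h => 7 * max_tree h + 1 <= 5 * max_tree h.+1)) => //.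
by move=> h h6 H0 H1; rewrite !max_tree_rec; lia.
Qed.

Lemma max_tree_ratio53 h : 3 <= h -> 3 * max_tree h.+1 <= 5 * max_tree h.
Proof.
move=> h3; case: (leqP 6 h) => [/max_tree_ratio32|]; first by lia.
by do 6![case: h h3 => [//|h] h3].
Qed.

Lemma max_tree_ratio2 h : 1 <= h -> max_tree h.+1 <= 2 * max_tree h.
Proof.
move=> h1; case: (leqP 3 h) => [/max_tree_ratio53|]; first by lia.
by do 3![case: h h1 => [//|h] h1].
Qed.

Lemma max_tree_diff2 h : 1 <= h -> max_tree h.+2 <= max_tree h.+1 + max_tree h.
Proof.
move=> h1; case: (ltnP h 6) => [|h6]; first by do 6![case: h h1 => [//|h] h1].
move: h h6 {h1}; apply: (@ind3 (fun h => max_tree h.+2 <= max_tree h.+1 + max_tree h)) => //.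
by move=> h h6 H0 H1; rewrite !max_tree_rec; lia.
Qed.

(** Together with [max_tree_diff2], this replaces a branch that is too high by one a level lower and
    one more ordinary branch. At [h = 3] it fails, 11 against 7 + 3. *)
Lemma max_tree_diff3 h : 4 <= h -> max_tree h.+3 <= max_tree h.+2 + max_tree h.
Proof.
move=> h1; case: (ltnP h 6) => [|h6]; first by do 6![case: h h1 => [//|h] h1].
move: h h6 {h1}; apply: (@ind3 (fun h => max_tree h.+3 <= max_tree h.+2 + max_tree h)) => //.
move=> h h6 H0 H1.
have := @max_tree_rec h.+3 (ltac:(lia)); have := @max_tree_rec h.+2 (ltac:(lia)).
by have := max_tree_rec h6; lia.
Qed.

Lemma max_tree_gt0 h : 0 < h -> 0 < max_tree h.
Proof. by case: h => [//|] [//|] [//|h] _; rewrite max_treeSSS. Qed.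

Lemma max_tree_mono : {homo max_tree : g h / g <= h}.
Proof.
apply: homo_leq => [||h]; [exact: leqnn|exact: leq_trans|].
by have := max_tree_ratio75 h; lia.
Qed.

(** A planted edge with [d] children of height [h] has height [d + h]. Four or more children reduce
    to fewer by trading one child for one more level. *)
Lemma max_tree_node d h : 0 < d -> (d * max_tree h).+1 <= max_tree (d + h).
Proof.
elim/ltn_ind: d h => d IH h d0.
case: (ltnP d 4) => [|d4]; last first.
  have := IH d.-1 (ltac:(lia)) h.+1 (ltac:(lia)).
  rewrite (_ : d.-1 + h.+1 = d + h); last by lia.
  by have := max_tree_ratio75 h; nia.
case: d d0 {IH} => [//|] [_ _|[_ _|[_ _|//]]].
- have := max_tree_ratio75 h; rewrite add1n.
  by case: h => [|h]; [by []|have := @max_tree_gt0 h.+1 isT; lia].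
- by case: h => [//|h]; rewrite addnC addn2 max_treeSSS; lia.
- by rewrite addnC addn3 max_treeSSS; lia.
Qed.

(* The maximal size of a family all of whose paths have at most [k] segments. *)
Definition max_family (k : nat) : nat :=
  maxn k
    (if odd k then maxn (3 * max_tree k./2) (5 * max_tree (k./2).-1)
     else maxn (4 * max_tree (k./2).-1) (6 * max_tree (k./2).-2)).

Lemma max_family_ge3 w : 3 * max_tree w <= max_family (2 * w).+1.
Proof.
rewrite /max_family /= mul2n odd_double /= uphalf_double.
by rewrite !leq_max leqnn orbT.
Qed.

Lemma max_family_ge4 w : 4 * max_tree w <= max_family (2 * w).+2.
Proof.
rewrite /max_family /= mul2n odd_double /= half_double /=.
by rewrite !leq_max leqnn orbT.
Qed.

Lemma max_family_ge5 w : 5 * max_tree w <= max_family (2 * w).+3.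
Proof.
rewrite /max_family /= mul2n odd_double /= uphalf_double /=.
by rewrite !leq_max leqnn !orbT.
Qed.

Lemma max_family_ge6 w : 6 * max_tree w <= max_family (2 * w).+4.
Proof.
rewrite /max_family /= mul2n odd_double /= half_double /=.
by rewrite !leq_max leqnn !orbT.
Qed.

(** Degrees from 7 on go down by two while the height goes up by one, which keeps [2 * w + d];
    degrees 1 and 2 are compared with degrees 3 and 4 at height [w - 1]. *)
Lemma max_family_balanced d w : 0 < d -> 0 < w ->
  d * max_tree w <= max_family (2 * w + d - 2).
Proof.
elim/ltn_ind: d w => d IH w d0 w0.
case: (ltnP d 7) => [d7|d7]; last first.
  have := IH (d - 2) (ltac:(lia)) w.+1 (ltac:(lia)) isT.
  rewrite (_ : 2 * w.+1 + (d - 2) - 2 = 2 * w + d - 2); last by lia.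
  by have := max_tree_ratio75 w; nia.
move: w0 d0 d7 {IH}.
case: w => [//|w] _; case: d => [//|] [|[|[|[|[|[|//]]]]]] _ _.
- case: w => [//|w]; have := max_family_ge3 w.+1.
  rewrite (_ : 2 * w.+2 + 1 - 2 = (2 * w.+1).+1); last by lia.
  by have := @max_tree_ratio2 w.+1 isT; lia.
- case: w => [//|w]; have := max_family_ge4 w.+1.
  rewrite (_ : 2 * w.+2 + 2 - 2 = (2 * w.+1).+2); last by lia.
  by have := @max_tree_ratio2 w.+1 isT; lia.
- rewrite (_ : _ + _ - _ = (2 * w.+1).+1); last by lia.
  exact: max_family_ge3.
- rewrite (_ : _ + _ - _ = (2 * w.+1).+2); last by lia.
  exact: max_family_ge4.
- rewrite (_ : _ + _ - _ = (2 * w.+1).+3); last by lia.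
  exact: max_family_ge5.
- rewrite (_ : _ + _ - _ = (2 * w.+1).+4); last by lia.
  exact: max_family_ge6.
Qed.

(** The shape of a tree at its centre: one branch of height [w1] and [d] others of height [w2]. Two
    exchanges keep [w1 + w2 + d] and shrink [w1 - w2] until all branches are equal: [stepw2] gives
    up one of the [d] branches to raise the others, [stepw1] lowers the high branch and adds an
    ordinary one. *)
Lemma max_family_bound w1 w2 d : 0 < w2 -> w2 <= w1 <= w2 + d ->
  max_tree w1 + d * max_tree w2 <= max_family (w1 + w2 + d - 1).
Proof.
have [e] := ubnP (w1 - w2); elim: e => // e IH in w1 w2 d *.
move=> lte w20 /andP[w12 w1d].
have [<-|neq] := eqVneq w2 w1.
  have := @max_family_balanced d.+1 w2 isT w20.
  by rewrite (_ : 2 * w2 + d.+1 - 2 = w2 + w2 + d - 1); lia.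
have stepw2 : d.-1 * max_tree w2.+1 >= d * max_tree w2 ->
    max_tree w1 + d * max_tree w2 <= max_family (w1 + w2 + d - 1).
  move=> le; have := IH w1 w2.+1 d.-1 (ltac:(lia)) isT (ltac:(lia)).
  by rewrite (_ : w1 + w2.+1 + d.-1 - 1 = w1 + w2 + d - 1); lia.
have stepw1 : max_tree w1 <= max_tree w1.-1 + max_tree w2 ->
    max_tree w1 + d * max_tree w2 <= max_family (w1 + w2 + d - 1).
  move=> le; have := IH w1.-1 w2 d.+1 (ltac:(lia)) w20 (ltac:(lia)).
  by rewrite (_ : w1.-1 + w2 + d.+1 - 1 = w1 + w2 + d - 1); lia.
case: (leqP 4 d) => [d4|d4].
  by apply: stepw2; have := max_tree_ratio75 w2; nia.
have : w1 = w2.+1 \/ w1 = w2.+2 \/ w1 = w2.+3 /\ d = 3 by lia.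
move=> [|[|]] E.
- by apply: stepw1; rewrite E /=; have := max_tree_ratio2 w20; lia.
- by apply: stepw1; rewrite E /=; have := max_tree_diff2 w20; lia.
- case: E => E Ed; case: (leqP 4 w2) => w24.
    by apply: stepw1; rewrite E /=; have := max_tree_diff3 w24; lia.
  (* For [w2] from 1 to 3 the lowering exchange may fail, but raising works:
     [3 * max_tree w2 <= 2 * max_tree w2.+1]. *)
  apply: stepw2; rewrite Ed; clear -w20 w24.
  by do 4![case: w2 w20 w24 => [//|w2] w20 w24].
Qed.

(** * Noncrossing matchings as forests *)

(* A noncrossing perfect matching of an interval: [Chord f g] matches the first
   point with the one following [f], and [g] is what comes after. *)
Inductive forest := Nil | Chord of forest & forest.

Fixpoint nodes F := if F is Chord f g then (nodes f + nodes g).+1 else 0.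

Fixpoint deg F := if F is Chord _ g then (deg g).+1 else 0.

(* [deg f + ht f] is the largest number of chords on a path that starts with a
   chord enclosing [f] and continues inside; 1 is the neutral value for [Nil]. *)
Fixpoint ht F := if F is Chord f g then maxn (deg f + ht f) (ht g) else 1.

Fixpoint fcat F G := if F is Chord f g then Chord f (fcat g G) else G.

(** Renumbering the curve from its second point: the chord of the old first point now ends at the
    last point, so [f] comes to the top level and [g] goes inside. In the dual tree the root moves
    across that chord. *)
Definition rotF F := if F is Chord f g then fcat f (Chord g Nil) else Nil.

Fixpoint layout o F : seq (nat * nat) :=
  if F is Chord f g then
    (o, o + (2 * nodes f).+1) ::
      layout o.+1 f ++ layout (o + (2 * nodes f).+2) g
  else [::].

Fixpoint tops o F : seq (nat * nat) :=
  if F is Chord f g then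
    (o, o + (2 * nodes f).+1) :: tops (o + (2 * nodes f).+2) g
  else [::].

Lemma ht_gt0 F : 0 < ht F.
Proof. by elim: F => //= f _ g IH; rewrite leq_max IH orbT. Qed.

Lemma nodes_fcat F G : nodes (fcat F G) = nodes F + nodes G.
Proof. by elim: F => //= f _ g ->; rewrite addSn addnA. Qed.

Lemma deg_fcat F G : deg (fcat F G) = deg F + deg G.
Proof. by elim: F => //= f _ g ->. Qed.

Lemma ht_fcat F G : ht (fcat F G) = maxn (ht F) (ht G).
Proof.
elim: F => /= [|f _ g ->]; last by rewrite maxnA.
by rewrite (maxn_idPr (ht_gt0 G)).
Qed.

Lemma fcatA F G H : fcat F (fcat G H) = fcat (fcat F G) H.
Proof. by elim: F => //= f _ g ->. Qed.

Lemma fcatN F : fcat F Nil = F.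
Proof. by elim: F => //= f _ g ->. Qed.

Lemma layout_fcat o F G :
  layout o (fcat F G) = layout o F ++ layout (o + 2 * nodes F) G.
Proof.
elim: F o => /= [|f _ g IH] o; first by rewrite muln0 addn0.
rewrite IH catA; congr (_ :: (_ ++ layout _ _)); lia.
Qed.

Lemma size_layout o F : size (layout o F) = nodes F.
Proof. by elim: F o => //= f IHf g IHg o; rewrite size_cat IHf IHg. Qed.

Lemma size_tops o F : size (tops o F) = deg F.
Proof. by elim: F o => //= f _ g IH o; rewrite IH. Qed.

(** By induction each top chord with its inside [f] is a planted tree of height [deg f + ht f], to
    which [max_tree_node] applies. *)
Lemma nodes_le_max_tree F : nodes F <= deg F * max_tree (ht F).
Proof.
elim: F => //= f IHf g IHg; rewrite mulSn.
have : (nodes f).+1 <= max_tree (deg f + ht f).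
  case: f IHf => // f1 f2 IHf.
  by apply: leq_trans (max_tree_node _ _) => //; rewrite ltnS.
move=> le1; have := max_tree_mono (leq_maxl (deg f + ht f) (ht g)).
have := leq_mul (leqnn (deg g)) (max_tree_mono (leq_maxr (deg f + ht f) (ht g))).
by lia.
Qed.

(** Greedy filling: the top chord takes as many of the [n] nodes as [max_tree w] allows, and the
    remaining [d - 1] top chords share the rest. This gives every size, not only the extremal
    ones. *)
Lemma forest_of_size d w n : n <= d * max_tree w -> 0 < w ->
  exists F, [/\ nodes F = n, deg F <= d & ht F <= w].
Proof.
elim/ltn_ind: w d n => w IHw; elim=> [|d IHd] n le w0.
  by exists Nil; split => /=; lia.
case: n => [|n] in le *; first by exists Nil.
set m := minn n.+1 (max_tree w).
have [|g [gn gd gh]] := IHd (n.+1 - m) _ w0; first by move: le; rewrite mulSn; lia.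
have m0 : 0 < m by have := max_tree_gt0 w0; rewrite /m; lia.
suff [f [fn fh]] : exists f, nodes f = m.-1 /\ deg f + ht f <= w.
  by exists (Chord f g); split => /=; [rewrite fn gn; move: m0; rewrite /m|
    |rewrite geq_max fh gh]; lia.
case: (leqP m 1) => m1; first by exists Nil; split => /=; lia.
(* [d'] is the number of children that attains the maximum in the recursion of [max_tree], or 1 for
   [w = 2]. *)
suff [d' [d0 dw le']] : exists d', [/\ 0 < d', d' < w & m.-1 <= d' * max_tree (w - d')].
  have [||f [fn fd fh]] := IHw (w - d') _ d' m.-1 le'; try by lia.
  by exists f; split => //; lia.
have : m <= max_tree w by rewrite /m geq_minr.
clear -w0 m1; move: m m1 => m; case: w w0 => [//|[|[|w]]] _ m1.
- by rewrite (_ : max_tree 1 = 1) //; lia.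
- by rewrite (_ : max_tree 2 = 2) // => ?; exists 1; rewrite (_ : max_tree _ = 1) //; split; lia.
- rewrite max_treeSSS => le; case: (leqP m.-1 (2 * max_tree w.+1)) => le2.
    by exists 2; rewrite (_ : w.+3 - 2 = w.+1) //; lia.
  exists 3; rewrite (_ : w.+3 - 3 = w); last by lia.
  case: w le le2 => [|w] le le2; last by split; lia.
  by move: le le2; rewrite (_ : max_tree 0 = 0) //; lia.
Qed.

Section Forests.
Implicit Types (c d e l t u : nat * nat) (s M : seq (nat * nat)).

Lemma layout_bounds o F c : c \in layout o F ->
  o <= c.1 /\ c.1 < c.2 /\ c.2 < o + 2 * nodes F.
Proof.
elim: F o => //= f IHf g IHg o; rewrite inE mem_cat.
by case/or3P => [/eqP-> /=|/IHf|/IHg]; lia.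
Qed.

(** * Bounding the paths that a forest admits *)

Definition inside (e c : nat * nat) := (e.1 < c.1) && (c.2 < e.2).

Definition outside (e c : nat * nat) :=
  [|| c.2 < e.1, e.2 < c.1 | (c.1 < e.1) && (e.2 < c.2)].

Lemma layout_tri o F c d : c \in layout o F -> d \in layout o F ->
  [\/ c = d, inside c d | outside c d].
Proof.
rewrite /inside /outside.
elim: F o => //= f IHf g IHg o; rewrite !inE !mem_cat.
case/or3P => [/eqP->|cf|cg]; case/or3P => [/eqP->|df|dg] /=;
  try by [constructor 1 | exact: IHf cf df | exact: IHg cg dg].
- by have := layout_bounds df; constructor 2; lia.
- by have := layout_bounds dg; constructor 3; lia.
- by have := layout_bounds cf; constructor 3; lia.
- by have := layout_bounds cf; have := layout_bounds dg; constructor 3; lia.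
- by have := layout_bounds cg; constructor 3; lia.
- by have := layout_bounds cg; have := layout_bounds df; constructor 3; lia.
Qed.

Lemma uniq_layout o F : uniq (layout o F).
Proof.
elim: F o => //= f IHf g IHg o; rewrite mem_cat cat_uniq IHf IHg /= andbT.
apply/andP; split.
  by apply/negP => /orP[] /layout_bounds /=; lia.
by apply/hasPn => c /layout_bounds cg; apply/negP => /layout_bounds; lia.
Qed.

Lemma tops_layout o F : {subset tops o F <= layout o F}.
Proof.
elim: F o => //= f _ g IH o c; rewrite !inE mem_cat => /orP[->//|/IH->].
by rewrite !orbT.
Qed.

Lemma layout_tops o F c : c \in layout o F ->
  c \in tops o F \/ exists2 t, t \in tops o F & inside t c.
Proof.
elim: F o => //= f _ g IH o; rewrite !inE mem_cat => /or3P[->|cf|/IH]; first by left.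
  right; exists (o, o + (2 * nodes f).+1); first exact: mem_head.
  by have := layout_bounds cf; rewrite /inside /=; lia.
case=> [->|[t tg ti]]; [by rewrite orbT; left|].
by right; exists t => //; rewrite inE tg orbT.
Qed.

Lemma tops_outside o F t u : t \in tops o F -> u \in tops o F -> t != u ->
  outside t u.
Proof.
rewrite /outside; elim: F o => //= f _ g IH o; rewrite !inE.
case/orP=> [/eqP->|tg] /orP[/eqP->|ug]; first by rewrite eqxx.
- by have := layout_bounds (tops_layout ug); move=> /=; lia.
- by have := layout_bounds (tops_layout tg); move=> /=; lia.
- exact: IH ug.
Qed.

Lemma tops_inner o F t : t \in tops o F ->
  exists f, [/\ {subset layout t.1.+1 f <= layout o F},
     nodes f < nodes F /\ deg f + ht f <= ht F,
     t.2 = t.1 + (2 * nodes f).+1 &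
     forall c, c \in layout o F -> inside t c -> c \in layout t.1.+1 f].
Proof.
elim: F o => //= f _ g IH o; rewrite !inE => /orP[/eqP->|/[dup]/tops_layout tl].
  exists f => /=; split=> [c cf||| c].
  - by rewrite inE mem_cat cf orbT.
  - by rewrite leq_maxl; lia.
  - by [].
  - rewrite inE mem_cat /inside => /or3P[/eqP->|//|/layout_bounds] /=; lia.
case/IH => h [sub [lt le] ed ins]; exists h; split=> [c /sub||| c] //.
- by rewrite inE mem_cat => ->; rewrite !orbT.
- by rewrite leq_max le orbT; lia.
- rewrite inE mem_cat => /or3P[/eqP->|cf|/ins//]; rewrite /inside /=.
    by have := layout_bounds tl; lia.
  by have := layout_bounds tl; have := layout_bounds cf; lia.
Qed.

(* No link between endpoints of [c] and [d] can avoid crossing [e]. *)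
Definition separates (e c d : nat * nat) :=
  inside e c && outside e d || outside e c && inside e d.

Definition linkable (M : seq (nat * nat)) c d :=
  all (fun e => ~~ separates e c d) M.

Lemma linkable_sym M : symmetric (linkable M).
Proof.
by move=> c d; apply: eq_all => e; rewrite /separates orbC [_ && inside _ _]andbC
  [outside _ _ && inside _ _]andbC.
Qed.

(** A chord other than [t] that is not inside [t] is outside it, and then [t] separates it from
    every chord inside. *)
Lemma path_trapped o F M t x s : {subset layout o F <= M} ->
  t \in layout o F -> inside t x -> {subset s <= layout o F} ->
  t \notin s -> path (linkable M) x s -> all (inside t) s.
Proof.
move=> sub tF; elim: s x => //= y s IH x tx sF.
rewrite inE negb_or => /andP[ty ts] /andP[/allP/(_ _ (sub _ tF)) xy ps].
have yF : y \in layout o F by apply: sF; exact: mem_head.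
have ity : inside t y.
  case: (layout_tri tF yF) ty xy => [->|//|oy]; first by rewrite eqxx.
  by rewrite /separates tx oy.
by rewrite ity (IH y) // => z zs; apply: sF; rewrite inE zs orbT.
Qed.

Section PathBound.
Variable M : seq (nat * nat).

Let starts_at_top o F (s : seq (nat * nat)) :=
  if s is c :: _ then c \in tops o F else true.

Let starts_below o F (s : seq (nat * nat)) :=
  if s is c :: _ then c \notin tops o F else false.

(* A path leaving the region of [F] through [t] never comes back. *)
Let descent o F t s :
  {subset layout o F <= M} -> t \in tops o F -> t \notin s ->
  {subset s <= layout o F} -> path (linkable M) t s ->
  starts_below o F s ->
  exists f p, [/\ {subset layout p f <= M}, nodes f < nodes F,
     deg f + ht f <= ht F, {subset s <= layout p f} & starts_at_top p f s].
Proof.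
case: s => // x s subM tt ts sF /= /andP[tx ps] xt.
have tF := tops_layout tt.
have xF : x \in layout o F by apply: sF; exact: mem_head.
have ix : inside t x.
  case: (layout_tops xF) => [|[u ut ux]]; first by rewrite (negPf xt).
  have [->//|tu] := eqVneq t u.
  have otu : outside u t by apply: tops_outside ut tt _; rewrite eq_sym.
  have /(_ u (subM _ (tops_layout ut))) := allP tx.
  by rewrite /separates otu ux orbT.
have [f [fF [lt le] et ins]] := tops_inner tt.
exists f, t.1.+1; split => //.
- by move=> c /fF /subM.
- have sF' : {subset s <= layout o F} by move=> c cs; apply: sF; rewrite inE cs orbT.
  have ts' : t \notin s by apply: contra ts => ts; rewrite inE ts orbT.
  have /allP al := path_trapped subM tF ix sF' ts' ps.
  by move=> c; rewrite inE => /orP[/eqP->|cs]; apply: ins => //; [exact: sF'|exact: al].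
(* A chord of [f] enclosing [x] would separate [x] from [t], so [x] is at the top level of [f]. *)
- have xf : x \in layout t.1.+1 f by exact: ins.
  case: (layout_tops xf) => // -[u ut ux].
  have uf := tops_layout ut.
  have /(_ u (subM _ (fF _ uf))) := allP tx.
  rewrite /separates ux andbT (_ : outside u t) ?orbT //.
  by move: (layout_bounds uf); rewrite /outside; clear -et; lia.
Qed.

(** The path spends at most [deg F] chords at the top level; once it goes below, it stays inside one
    top chord, where induction leaves fewer than [ht F] chords. *)
Let path_from_top o F s : {subset layout o F <= M} -> uniq s ->
  {subset s <= layout o F} -> sorted (linkable M) s -> starts_at_top o F s ->
  s != [::] -> size s < deg F + ht F.
Proof.
have [m] := ubnP (nodes F); elim: m => // m IH in o F s * => ltm subM us sF ps st sn.
set i := find (fun c => c \notin tops o F) s.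
have topB : {subset take i s <= tops o F}.
  move=> c /(nthP (0,0))[j jlt <-]; rewrite size_take in jlt.
  have ji : j < i.
    move: jlt; case: ifP => //.
    by have := find_size (fun c => c \notin tops o F) s; rewrite -/i; lia.
  by rewrite nth_take //; have /negbFE := before_find (0,0) ji.
have sB : size (take i s) <= deg F.
  by rewrite -(size_tops o F); apply: uniq_leq_size topB; exact: take_uniq.
case: (ltnP i (size s)) => [ilt|ige]; last first.
  by move: sB; rewrite take_oversize //; have := ht_gt0 F; lia.
have i0 : 0 < i by case: s st sn @i {us sF ps topB sB ilt} => //= c s ->.
have hs : has (fun c => c \notin tops o F) s by rewrite has_find.
have xn : nth (0,0) s i \notin tops o F := nth_find (0,0) hs.
clearbody i.
have Ed : drop i s = nth (0,0) s i :: drop i.+1 s by apply: drop_nth.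
set t := nth (0,0) s i.-1.
have Ed' : drop i.-1 s = t :: drop i s.
  by rewrite -{2}(prednK i0); apply: drop_nth; lia.
have tt : t \in tops o F.
  have ii : i.-1 < i by lia.
  apply: topB; apply/(nthP (0,0)); exists i.-1; last by rewrite nth_take.
  by rewrite size_takel // ltnW.
have pt : path (linkable M) t (drop i s).
  by have := drop_sorted i.-1 ps; rewrite Ed'.
have tn : t \notin drop i s.
  by have := drop_uniq i.-1 us; rewrite Ed' /= => /andP[].
have sFd : {subset drop i s <= layout o F} by move=> c /mem_drop /sF.
have hd : starts_below o F (drop i s) by rewrite Ed.
have [f [p [fM lt le sf sp]]] := descent subM tt tn sFd pt hd.
have := IH p f (drop i s) _ fM (drop_uniq i us).
have pd : sorted (linkable M) (drop i s) := path_sorted pt.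
move=> /(_ (ltac:(clear -lt ltm; lia)) sf pd sp).
rewrite {1}Ed => /(_ isT); rewrite -[in size s](cat_take_drop i s) size_cat.
by clear -sB le; lia.
Qed.

(** Cut the path at its first top chord [c]. The part before [c], read backwards, descends from [c]
    and has fewer than [ht F] chords; the part from [c] on is bounded by [path_from_top]. *)
Lemma path_size o F s : {subset layout o F <= M} -> uniq s ->
  {subset s <= layout o F} -> sorted (linkable M) s ->
  size s <= deg F + 2 * ht F - 2.
Proof.
have [m] := ubnP (nodes F); elim: m => // m IH in o F s * => ltm subM us sF ps.
case: (boolP (has (mem (tops o F)) s)) => [hs|/hasPn hs]; last first.
  (* A path that avoids all top chords is trapped inside one of them, and induction applies to the
     forest there. *)
  case: s => // x s in us sF ps hs *.
  have xF : x \in layout o F by apply: sF; exact: mem_head.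
  have xt : x \notin tops o F by apply: hs; exact: mem_head.
  case: (layout_tops xF) => [|[t tt ix]]; first by rewrite (negPf xt).
  have [f [fF [lt le] et ins]] := tops_inner tt.
  have tF := tops_layout tt.
  have sF' : {subset s <= layout o F} by move=> c cs; apply: sF; rewrite inE cs orbT.
  have ts : t \notin s.
    by apply/negP => ts; have := hs t; rewrite inE ts orbT => /(_ isT); rewrite /= tt.
  have /allP al := path_trapped subM tF ix sF' ts ps.
  have sf : {subset x :: s <= layout t.1.+1 f}.
    by move=> c; rewrite inE => /orP[/eqP->|cs]; apply: ins => //; [exact: sF'|exact: al].
  have := IH t.1.+1 f (x :: s) _ _ us sf ps.
  move=> /(_ (ltac:(clear -lt ltm; lia)) (fun c cf => subM c (fF c cf))).
  case: f {et ins sf} => [|f g] in fF lt le *; first by [].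
  by move: (ht_gt0 F) le => /=; clear; lia.
set i := find (mem (tops o F)) s.
have ilt : i < size s by rewrite -has_find.
set c := nth (0,0) s i.
have ct : c \in tops o F by exact: (nth_find (0,0) hs).
have bf j : j < i -> nth (0,0) s j \notin tops o F.
  by move=> ji; have /= -> := before_find (0,0) ji.
clearbody i.
have Ed : drop i s = c :: drop i.+1 s by exact: drop_nth.
have sz2 : size (drop i s) < deg F + ht F.
  apply: (path_from_top subM (drop_uniq i us)) => [d /mem_drop/sF//|||].
  - exact: drop_sorted.
  - by rewrite Ed.
  - by rewrite Ed.
suff sz1 : size (take i s) < ht F.
  by rewrite -[in size s](cat_take_drop i s) size_cat; lia.
have n1 : forall d, d \in take i s -> d \notin tops o F.
  move=> d /(nthP (0,0))[j]; rewrite (size_takel (ltnW ilt)) => ji <-.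
  by rewrite nth_take // bf.
have pc : path (linkable M) c (rev (take i s)).
  have := take_sorted i.+1 ps; rewrite (take_nth (0,0)) // -/c => so.
  have : sorted (linkable M) (rev (rcons (take i s) c)).
    by rewrite rev_sorted; under eq_sorted => x y do rewrite linkable_sym.
  by rewrite rev_rcons.
have [E|ne] := eqVneq (take i s) [::]; first by rewrite E ht_gt0.
have [|||f [p [fM lt le sf sp]]] := descent subM ct _ _ pc.
- rewrite mem_rev; apply/negP => /n1; by rewrite ct.
- by move=> d; rewrite mem_rev => /mem_take /sF.
- case E : (rev (take i s)) => [|d r].
    by move: (congr1 size E) ne; rewrite size_rev -size_eq0 => ->.
  by apply: n1; rewrite -mem_rev E mem_head.
rewrite -size_rev; apply: leq_trans le.
apply: (path_from_top fM _ sf (path_sorted pc) sp).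
  by rewrite rev_uniq take_uniq.
by rewrite -size_eq0 size_rev size_eq0.
Qed.
End PathBound.

(** * Rotations and the centre of the dual tree *)

Definition rotates F G := exists i, iter i rotF F = G.

Lemma rotates_trans F G H : rotates F G -> rotates G H -> rotates F H.
Proof. by move=> [i <-] [j <-]; exists (j + i); rewrite iterD. Qed.

Lemma rotates_fcat F G : rotates (fcat F G) (fcat G F).
Proof.
elim: F G => [|f IHf g IHg] G /=; first by exists 0; rewrite /= fcatN.
apply: (@rotates_trans _ (fcat f (Chord (fcat g G) Nil))); first by exists 1.
apply: (rotates_trans (IHf _)); rewrite /=.
apply: (@rotates_trans _ (fcat (fcat g G) (Chord f Nil))); first by exists 1.
by rewrite -fcatA; apply: (rotates_trans (IHg _)); rewrite -fcatA; exists 0.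
Qed.

Lemma nodes_rotF F : nodes (rotF F) = nodes F.
Proof. by case: F => //= f g; rewrite nodes_fcat /= addn0 addnS. Qed.

Lemma nodes_rotates F G : rotates F G -> nodes G = nodes F.
Proof. by move=> [i <-]; elim: i => //= i <-; rewrite nodes_rotF. Qed.

Lemma ht_attained F : 0 < nodes F ->
  exists a f b, F = fcat a (Chord f b) /\ deg f + ht f = ht F.
Proof.
elim: F => //= f _ g IH _; case: (leqP (ht g) (deg f + ht f)) => le.
  by exists Nil, f, g.
case: g => [|g1 g2] in IH le *; first by have := ht_gt0 f; move: le => /=; lia.
have [//|a [h [b [-> <-]]]] := IH.
by exists (Chord f a), h, b.
Qed.

(* Moving the outer region towards the deepest chord as long as this lowers the
   height reaches a centre of the dual tree. *)
Lemma rotates_centre F : 0 < nodes F -> exists f g,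
  rotates F (Chord f g) /\ ht g <= deg f + ht f <= ht g + deg g.
Proof.
have [m] := ubnP (ht F); elim: m => // m IH in F * => ltm n0.
have [a [f [b [EF Ef]]]] := ht_attained n0.
pose g := fcat b a.
have rF : rotates F (Chord f g) by rewrite EF; apply: rotates_fcat.
have hg : ht g <= deg f + ht f.
  by rewrite Ef EF /g !ht_fcat /= geq_max; apply/andP; split; lia.
case: (leqP (deg f + ht f) (ht g + deg g)) => le.
  by exists f, g; rewrite hg le.
have rG : rotates F (fcat f (Chord g Nil)).
  by apply: (rotates_trans rF); exists 1.
have [||f' [g' [r H]]] := IH (fcat f (Chord g Nil)).
(* The new height is the maximum of [ht f] and [deg g + ht g]. For it to be smaller, [f] must be
   nonempty: with [f = Nil] the inequality [le] would put [ht g + deg g] below 1. *)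
- rewrite ht_fcat /=; case: f Ef EF rF rG hg le => [|f1 f2] Ef _ _ _ _ le.
    by have := ht_gt0 g; move: le => /=; lia.
  have := ht_gt0 (Chord f1 f2); move: Ef le ltm.
  by rewrite [deg (Chord f1 f2)]/=; lia.
- by rewrite nodes_fcat /= addn0; lia.
by exists f', g'; split => //; exact: rotates_trans rG r.
Qed.

(* For labels of points along a convex curve, [cross e l] holds when the chords
   with end labels [e] and [l] meet in their interiors. *)
Definition between (a b x : nat) := (a < x < b) || (b < x < a).
Definition beyond (a b x : nat) := (x < a) && (x < b) || (a < x) && (b < x).
Definition cross (e l : nat * nat) :=
  between e.1 e.2 l.1 && beyond e.1 e.2 l.2 ||
  beyond e.1 e.2 l.1 && between e.1 e.2 l.2.

Lemma cross_sym e l : cross e l = cross l e.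
Proof. by rewrite /cross /between /beyond; lia. Qed.

Lemma crossC1 a b l : cross (a, b) l = cross (b, a) l.
Proof. by rewrite /cross /between /beyond /=; lia. Qed.

Lemma crossC2 e a b : cross e (a, b) = cross e (b, a).
Proof. by rewrite cross_sym crossC1 cross_sym. Qed.

(** The partner of [a] splits the interval into the points it encloses with [a] and those after it;
    since nothing crosses this chord, [m] preserves both parts. *)
Lemma forest_of_matching (m : nat -> nat) (a b : nat) : a <= b ->
  (forall x, a <= x < b -> [/\ a <= m x < b, m (m x) = x & m x <> x]) ->
  (forall x y, a <= x < b -> a <= y < b -> ~~ cross (x, m x) (y, m y)) ->
  exists F, b = a + 2 * nodes F /\
    forall e, e \in layout a F <-> [/\ a <= e.1, e.1 < e.2, e.2 < b & m e.1 = e.2].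
Proof.
have [n] := ubnP (b - a); elim: n => // n IH in a b * => ltn ab ma mx.
have [<-|neq] := eqVneq a b.
  exists Nil; split => [|e]; first by rewrite addn0.
  by split => [//|[] *]; exfalso; lia.
have [mab mma mna] := ma a (ltac:(lia)).
have ins x : a < x < m a -> a < m x < m a.
  move=> ax; have := mx a x (ltac:(lia)) (ltac:(lia)).
  have [] := ma x (ltac:(lia)); rewrite /cross /between /beyond /= => + mmx + .
  have mxa : m x <> a by move=> E; move: mmx; rewrite E; lia.
  have mxma : m x <> m a by move=> E; move: mmx; rewrite E; lia.
  by lia.
have out x : m a < x < b -> m a < m x < b.
  move=> ax; have := mx a x (ltac:(lia)) (ltac:(lia)).
  have [] := ma x (ltac:(lia)); rewrite /cross /between /beyond /= => + mmx + .
  have mxa : m x <> a by move=> E; move: mmx; rewrite E; lia.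
  have mxma : m x <> m a by move=> E; move: mmx; rewrite E; lia.
  by lia.
have [|||f [nf lf]] := IH a.+1 (m a) (ltac:(lia)).
- by lia.
- by move=> x ax; have [_ ? ?] := ma x (ltac:(lia)); split=> //; apply: ins; lia.
- by move=> x y ? ?; apply: mx; lia.
have [|||g [ng lg]] := IH (m a).+1 b (ltac:(lia)).
- by lia.
- by move=> x ax; have [_ ? ?] := ma x (ltac:(lia)); split=> //; apply: out; lia.
- by move=> x y ? ?; apply: mx; lia.
have E1 : a + (2 * nodes f).+1 = m a by lia.
exists (Chord f g); split=> [|[e1 e2]] /=; first by lia.
rewrite inE mem_cat E1 (_ : a + (2 * nodes f).+2 = (m a).+1); last by lia.
split.
  case/or3P => [/eqP[-> ->]|/lf|/lg] /=; first by split=> //; lia.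
    by case=> ? ? ? ?; split => //; lia.
  by case=> ? ? ? ?; split => //; lia.
move=> /= [ae e12 eb me].
have [E|ne] := eqVneq e1 a; first by rewrite -me E eqxx.
apply/orP; right; apply/orP.
case: (ltngtP e1 (m a)) => e1m.
- by left; apply/lf; split => //=; [lia|rewrite -me; have := ins e1; lia].
- by right; apply/lg; split => //=; lia.
- by exfalso; move: me e12; rewrite e1m mma; lia.
Qed.

(** * Long alternating chains *)

Definition swap c := (c.2, c.1).

(** A pair in [s] is a segment traversed from its first to its second label. The links are the other
    edges of the chain, the first one coming from [x]. *)
Fixpoint links (x : nat) s :=
  if s is c :: s' then (x, c.1) :: links c.2 s' else [::].

Definition pts s := flatten [seq [:: c.1; c.2] | c <- s].

Definition noncrossing : seq (nat * nat) -> bool :=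
  pairwise (fun l k => ~~ cross l k).

Definition oriented s c := (c \in s) || (swap c \in s).

Lemma pts_cons c s : pts (c :: s) = [:: c.1, c.2 & pts s].
Proof. by []. Qed.

Lemma mem_links x s l : l \in links x s -> l.1 \in x :: pts s /\ l.2 \in pts s.
Proof.
elim: s x => //= c s IH x; rewrite pts_cons !inE => /orP[/eqP-> /=|/IH[]].
  by rewrite !eqxx.
by rewrite inE => -> ->; rewrite !orbT.
Qed.

Lemma mem_pts x s : x \in pts s -> exists2 c, c \in s & x = c.1 \/ x = c.2.
Proof.
elim: s => //= c s IH; rewrite pts_cons !inE => /or3P[/eqP->|/eqP->|/IH[d ds]].
- by exists c; [exact: mem_head|left].
- by exists c; [exact: mem_head|right].
- by exists d; first by rewrite inE ds orbT.
Qed.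

Lemma oriented_bounds o F s x : {in s, forall c, oriented (layout o F) c} ->
  x \in pts s -> o <= x < o + 2 * nodes F.
Proof.
move=> sF /mem_pts[c /sF /orP[] /layout_bounds /= + [] ->]; lia.
Qed.

(* From a point [x] bordering the region above [F], a path can use up all the
   chords of that region from both ends and finish inside the deepest one. *)
Lemma walk M o F (x : nat) : {subset layout o F <= M} ->
  x < o \/ o + 2 * nodes F <= x ->
  (forall e, e \in M -> e \in layout o F \/
     forall y, o <= y < o + 2 * nodes F ->
       [/\ y <> e.1, y <> e.2 & ~~ cross e (x, y)]) ->
  exists s, [/\ size s = deg F + ht F - 1,
    (forall c, c \in s -> oriented (layout o F) c),
    uniq (pts s),
    (forall l e, l \in links x s -> e \in M -> ~~ cross e l) &
    noncrossing (links x s)].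
Proof.
have [m] := ubnP (nodes F); elim: m => // m IH in o F x * => ltm FM xo Me.
(* One step of the walk: link [x] to [y], traverse the chord to [z], go on in [F'] from [z]. The
   labels [lo] to [hi] contain [z] and all later points but neither [x] nor [y], so no later link
   crosses the link from [x] to [y]. *)
have glue o' F' (y z lo hi : nat) :
    nodes F' < nodes F -> {subset layout o' F' <= layout o F} ->
    deg F' + ht F' = deg F + ht F - 1 -> oriented (layout o F) (y, z) ->
    lo <= z <= hi /\ (z < o' \/ o' + 2 * nodes F' <= z) ->
    lo <= o' /\ o' + 2 * nodes F' <= hi.+1 ->
    o <= o' /\ o' + 2 * nodes F' <= o + 2 * nodes F ->
    ~~ (lo <= x <= hi) /\ ~~ (lo <= y <= hi) ->
    (forall e, e \in layout o F -> ~~ cross e (x, y)) ->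
    (forall e, e \in layout o F -> e \in layout o' F' \/
       forall y', o' <= y' < o' + 2 * nodes F' ->
       [/\ y' <> e.1, y' <> e.2 & ~~ cross e (z, y')]) ->
    exists s, [/\ size s = deg F + ht F - 1,
      (forall c, c \in s -> oriented (layout o F) c),
      uniq (pts s),
      (forall l e, l \in links x s -> e \in M -> ~~ cross e l) &
      noncrossing (links x s)].
  move=> ltF sub dF ori [Jz zo] [Jlo Jhi] spanF [xJ yJ] Hxy He.
  have spanyz : o <= y < o + 2 * nodes F /\ o <= z < o + 2 * nodes F.
    by case/orP: ori => /layout_bounds /=; clear; lia.
  have [||||s [ss so us sM sn]] := IH o' F' z.
  - by clear -ltF ltm; lia.
  - by move=> e /sub/FM.
  - exact: zo.
  - move=> e eM; case: (Me e eM) => [/He//|Mx]; right => y' y'o.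
    have [|y'1 y'2 cy'] := Mx y'; first by clear -y'o spanF; lia.
    have n1 : ~~ (o <= e.1 < o + 2 * nodes F) by apply/negP => /Mx[].
    have n2 : ~~ (o <= e.2 < o + 2 * nodes F) by apply/negP => /Mx[].
    split=> //; move: n1 n2 spanyz spanF y'o; rewrite /cross /between /beyond /=.
    by clear; lia.
  have sJ p : p \in pts s -> lo <= p <= hi /\ p <> z.
    by move=> /(oriented_bounds so); move: Jz zo Jlo Jhi; clear; lia.
  exists ((y, z) :: s); split.
  - by rewrite /= ss; move: dF (ht_gt0 F') (ht_gt0 F); clear; lia.
  - move=> c; rewrite inE => /orP[/eqP->//|/so]; rewrite /oriented.
    by case/orP => /sub ->; rewrite ?orbT.
  - rewrite pts_cons /= us andbT inE negb_or -andbA; apply/and3P; split.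
    + by apply/eqP => E; move: Jz yJ; rewrite -E => ->.
    + by apply/negP => /sJ[+ _]; apply/negP.
    + by apply/negP => /sJ[].
  - move=> l e /=; rewrite inE => /orP[/eqP-> eM|/sM//]; last exact.
    case: (Me e eM) => [/Hxy//|Mx].
    by case: (Mx y) => //; case: spanyz.
  - rewrite /noncrossing /= -/(noncrossing _) sn andbT.
    apply/allP => l /mem_links[]; rewrite inE => l1 /sJ[l2 _].
    have {}l1 : lo <= l.1 <= hi by case/orP: l1 => [/eqP->//|/sJ[]].
    move: l1 l2 xJ yJ; rewrite /cross /between /beyond /=.
    by clear; lia.
have nocross (y : nat) : y = o \/ y.+1 = o + 2 * nodes F ->
    forall e, e \in layout o F -> ~~ cross e (x, y).
  move=> yo e /layout_bounds; move: xo yo; rewrite /cross /between /beyond /=.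
  by clear; lia.
case: F => [|f g] in ltm FM xo Me glue nocross *.
  by exists [::]; split.
(* Only one top chord is left: traverse it and continue inside it. *)
have [gN|gN] := eqVneq (nodes g) 0.
  case: g gN ltm FM xo Me glue nocross => //= _ ltm FM xo Me glue nocross.
  have hf := ht_gt0 f.
  apply: (glue o.+1 f o (o + (2 * nodes f).+1) o.+1 (o + (2 * nodes f).+1)).
  - by clear; lia.
  - by move=> e ef; rewrite inE mem_cat ef orbT.
  - by clear -hf; lia.
  - by rewrite /oriented inE eqxx.
  - by clear; lia.
  - by clear; lia.
  - by clear; lia.
  - by move: xo; clear; lia.
  - by apply: nocross; left.
  - move=> e; rewrite inE cats0 => /orP[/eqP->|]; last by left.
    by right=> y' /=; rewrite /cross /between /beyond /=; clear; split; lia.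
(* If the height is attained after the first chord, that chord is used up from the left. *)
case: (leqP (deg f + ht f) (ht g)) => le.
  apply: (glue (o + (2 * nodes f).+2) g o (o + (2 * nodes f).+1)
    (o + (2 * nodes f).+1) (o + 2 * nodes (Chord f g)).-1).
  - by rewrite /=; clear; lia.
  - by move=> e ef; rewrite /= inE mem_cat ef !orbT.
  - by rewrite /= (maxn_idPr le); clear; lia.
  - by rewrite /oriented inE eqxx.
  - by rewrite /=; clear; lia.
  - by rewrite /=; clear; lia.
  - by rewrite /=; clear; lia.
  - by move: xo; rewrite /=; clear; lia.
  - by apply: nocross; left.
  - move=> e /=; rewrite inE mem_cat => /or3P[/eqP->|/layout_bounds ef|]; last by left.
    + by right=> y' /=; rewrite /cross /between /beyond /=; clear; split; lia.
    + by right=> y' /=; move: ef; rewrite /cross /between /beyond /=; clear; split; lia.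
(* Here the first chord is strictly the deepest and is kept for the end: the last chord is used up,
   from its right endpoint to its left one. *)
have [G [h [EF Gh nG]]] : exists G h, [/\ Chord f g = fcat G (Chord h Nil),
     ht G = ht (Chord f g) & 0 < nodes G].
  have [g' [h Eg]] : exists g' h, g = fcat g' (Chord h Nil).
    elim: g gN {ltm FM xo Me glue nocross le} => //= g1 _ g2 IHg _.
    case: g2 IHg => [_|g3 g4 /(_ isT)[g' [h ->]]]; first by exists Nil, g1.
    by exists (Chord g1 g'), h.
  exists (Chord f g'), h; split=> //=; first by rewrite -Eg.
  by move: le; rewrite Eg ht_fcat; clear; lia.
rewrite EF in ltm FM xo Me glue nocross *.
have nE : nodes (fcat G (Chord h Nil)) = nodes G + (nodes h).+1.
  by rewrite nodes_fcat /= addn0.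
have lE : layout o (fcat G (Chord h Nil)) = layout o G ++
    (o + 2 * nodes G, o + 2 * nodes G + (2 * nodes h).+1) :: layout (o + 2 * nodes G).+1 h.
  by rewrite layout_fcat /= cats0.
apply: (glue o G (o + 2 * nodes G + (2 * nodes h).+1) (o + 2 * nodes G) o (o + 2 * nodes G)).
- by rewrite nE; clear; lia.
- by move=> e eG; rewrite lE mem_cat eG.
- by rewrite deg_fcat -EF -Gh /=; move: (ht_gt0 G); clear; lia.
- by rewrite /oriented /swap lE !mem_cat !inE eqxx !orbT.
- by clear; lia.
- by clear; lia.
- by rewrite nE; clear; lia.
- by move: xo; rewrite nE; move: nG; clear; lia.
- by apply: nocross; right; rewrite nE; clear; lia.
- move=> e; rewrite lE mem_cat inE => /or3P[|/eqP->|/layout_bounds eh]; first by left.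
  + by right=> y' /=; rewrite /cross /between /beyond /=; clear; split; lia.
  + by right=> y' /=; move: eh; rewrite /cross /between /beyond /=; clear; split; lia.
Qed.

Lemma max_family_mono : {homo max_family : j k / j <= k}.
Proof.
apply: homo_leq => [||k]; [exact: leqnn|exact: leq_trans|].
rewrite {1}/max_family geq_max; apply/andP; split.
  by rewrite /max_family; apply: leq_trans (leq_maxl _ _).
have := odd_double_half k; move: k./2 => w; case: (odd k) => <-.
- rewrite (_ : (true + w.*2).+1 = (2 * w).+2); last by lia.
  have := max_family_ge4 w; rewrite geq_max.
  by case: w => [//|w]; have := max_tree_ratio75 w; rewrite /=; lia.
- case: w => [//|w]; have := max_family_ge3 w.+1; have := max_family_ge5 w.
  rewrite (_ : (2 * w).+3 = (2 * w.+1).+1); last by lia.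
  rewrite (_ : (false + w.+1.*2).+1 = (2 * w.+1).+1); last by lia.
  have := max_tree_ratio75 w; rewrite geq_max /=.
  have : max_tree 0 = 0 by [].
  by case: w => [|w] /=; [|have := max_tree_ratio75 w]; lia.
Qed.

Definition inner_links s := if s is c :: s' then links c.2 s' else [::].

Lemma inner_links_rev_cat s1 c s2 :
  inner_links (rev (map swap s1) ++ c :: s2) =
  rev (map swap (links c.1 s1)) ++ links c.2 s2.
Proof.
elim: s1 c s2 => //= d s1 IH c s2.
by rewrite rev_cons cat_rcons IH /= rev_cons cat_rcons.
Qed.

Lemma pts_cat s1 s2 : pts (s1 ++ s2) = pts s1 ++ pts s2.
Proof. by rewrite /pts map_cat flatten_cat. Qed.

Lemma pts_rev_swap s : pts (rev (map swap s)) = rev (pts s).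
Proof.
elim: s => //= c s IH; rewrite rev_cons -cats1 pts_cat IH pts_cons.
by rewrite !rev_cons -!cats1 -catA.
Qed.

Lemma pairwise_rev (T : Type) (r : rel T) (s : seq T) : symmetric r ->
  pairwise r (rev s) = pairwise r s.
Proof.
move=> rs; elim: s => //= x s IH; rewrite rev_cons -cats1 pairwise_cat IH /=.
by rewrite andbT allrel1r all_rev; congr (_ && _); apply: eq_all.
Qed.

Lemma noncrossing_rev_swap s : noncrossing (rev (map swap s)) = noncrossing s.
Proof.
rewrite /noncrossing pairwise_rev => [|l k]; last by rewrite cross_sym.
by rewrite pairwise_map; apply: eq_pairwise => -[a b] [a' b'] /=;
  rewrite /swap /= crossC1 crossC2.
Qed.

Definition alternating M s := [/\ forall c, c \in s -> oriented M c, uniq (pts s),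
  forall l e, l \in inner_links s -> e \in M -> ~~ cross e l &
  noncrossing (inner_links s)].

(** The first chord [(0, r)] is extended by a walk from [0] into [f], reversed, and a walk from [r]
    into [g]. Links of the two walks cannot cross, since their labels are below [r] and at least [r]
    respectively. *)
Lemma long_alternating f g :
  exists2 s, size s = deg f + ht f + ht g + deg g - 1 &
    alternating (layout 0 (Chord f g)) s.
Proof.
set M := layout 0 _; pose r := (2 * nodes f).+1.
have fM : {subset layout 1 f <= M}.
  by move=> e ef; rewrite /M /= inE mem_cat ef orbT.
have gM : {subset layout r.+1 g <= M}.
  by move=> e eg; rewrite /M /= inE mem_cat eg !orbT.
have rM : (0, r) \in M by rewrite /M /= mem_head.
have [|e|s1 [ss1 so1 us1 sM1 sn1]] := @walk M 1 f 0 fM; first by left.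
  rewrite /M /= inE mem_cat => /or3P[/eqP->|->|/layout_bounds eg]; [right|by left|right].
    by move=> y /=; rewrite /cross /between /beyond /=; clear; split; lia.
  by move=> y; move: eg; rewrite /cross /between /beyond /=; clear; split; lia.
have [|e|s2 [ss2 so2 us2 sM2 sn2]] := @walk M r.+1 g r gM; first by left.
  rewrite /M /= inE mem_cat => /or3P[/eqP->|/layout_bounds ef|->]; [right|right|by left].
    by move=> y /=; rewrite /cross /between /beyond /=; rewrite /r; clear; split; lia.
  by move=> y; move: ef; rewrite /cross /between /beyond /= /r; clear; split; lia.
have b1 p : p \in pts s1 -> 0 < p < r.
  by move=> /(oriented_bounds so1); rewrite /r; clear; lia.
have b2 p : p \in pts s2 -> r < p.
  by move=> /(oriented_bounds so2); rewrite /r; clear; lia.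
exists (rev (map swap s1) ++ (0, r) :: s2).
  rewrite size_cat size_rev size_map /= ss1 ss2.
  by move: (ht_gt0 f) (ht_gt0 g); clear; lia.
split.
- move=> c; rewrite mem_cat mem_rev inE => /or3P[/mapP[d /so1 + ->]|/eqP->|/so2].
  + by rewrite /oriented /swap /= -surjective_pairing orbC => /orP[] /fM ->; rewrite ?orbT.
  + by rewrite /oriented rM.
  + by rewrite /oriented => /orP[] /gM ->; rewrite ?orbT.
- rewrite pts_cat pts_rev_swap cat_uniq rev_uniq us1 pts_cons /= us2 !inE !mem_rev andbT.
  rewrite !negb_or -!andbA; apply/and5P; split.
  + by apply/negP => /b1.
  + by apply/negP => /b1; rewrite ltnn andbF.
  + apply/hasPn => p /b2; rewrite /= mem_rev => rp; apply/negP => /b1.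
    by move: rp; clear; lia.
  + by rewrite /r.
  + by apply/andP; split; apply/negP => /b2; rewrite ?ltnn.
- move=> l e; rewrite inner_links_rev_cat mem_cat mem_rev => /orP[|/sM2]; last by apply.
  by case/mapP => k /sM1 + -> => /[apply]; case: k => a b; rewrite crossC2.
- rewrite inner_links_rev_cat /noncrossing pairwise_cat -/(noncrossing _).
  rewrite noncrossing_rev_swap sn1 -/(noncrossing (links _ _)) sn2 !andbT.
  apply/allrelP => l k; rewrite mem_rev => /mapP[l' /mem_links[l1 l2] ->] /mem_links[k1 k2].
  have {}l1 : l'.1 < r by move: l1; rewrite inE => /orP[/eqP->|/b1/andP[]].
  have {}l2 : l'.2 < r by case/b1/andP: l2.
  have {}k1 : r <= k.1 by move: k1; rewrite inE => /orP[/eqP->|/b2/ltnW].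
  have {}k2 : r <= k.2 by case/b2/ltnW: k2.
  by move: l1 l2 k1 k2; rewrite /cross /between /beyond /=; clear; lia.
Qed.

Lemma links_take x s k : links x (take k s) = take k (links x s).
Proof. by elim: s x k => [|c s IH] x [|k] //=; rewrite IH. Qed.

Lemma pts_take s k : pts (take k s) = take (2 * k) (pts s).
Proof.
elim: s k => [//|c s IH] [|k]; first by rewrite muln0 !take0.
by rewrite mulnS [take _ _]/= !pts_cons /= IH.
Qed.

Lemma alternating_take M s k : alternating M s -> alternating M (take k s).
Proof.
case=> so su sM sn; have E : exists j, inner_links (take k s) = take j (inner_links s).
  case: s {so su sM sn} => [|c s]; first by exists 0.
  by case: k => [|k]; [exists 0; rewrite !take0|exists k; rewrite /= links_take].
case: E => j E; split.
- by move=> c /mem_take/so.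
- by rewrite pts_take take_uniq.
- by move=> l e; rewrite E => /mem_take/sM; apply.
- rewrite E /noncrossing; apply: (subseq_pairwise _ sn).
  exact: take_subseq.
Qed.

(** At a centre, a chain with fewer than [k] segments would bound the size by [max_family k.-1],
    through [max_family_bound]. The chain is cut because exactly [k] segments are demanded. *)
Lemma exists_alternating F k : max_family k.-1 < nodes F -> 
  exists G s, [/\ rotates F G, size s = k & alternating (layout 0 G) s].
Proof.
move=> lt; have [f [g [rF /andP[h1 h2]]]] := rotates_centre (leq_ltn_trans (leq0n _) lt).
have [s ss sa] := long_alternating f g.
exists (Chord f g), (take k s); split => //; last exact: alternating_take.
apply: size_takel; rewrite leqNgt; apply/negP => ltk.
have := max_family_bound (ht_gt0 g) (introT andP (conj h1 h2)).
rewrite -ss => le; move: lt; rewrite ltnNge => /negP; apply.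
rewrite -(nodes_rotates rF) /=; apply: leq_trans (leq_trans le _).
  have := nodes_le_max_tree (Chord f Nil); have := nodes_le_max_tree g => /=.
  by rewrite (maxn_idPl _) ?addn_gt0 ?ht_gt0 ?orbT //; lia.
by apply: max_family_mono; lia.
Qed.

(** The [minn] accounts for the value [k] in [max_family]: with at most [k] segments any forest will
    do. *)
Lemma exists_short_forest n k : n <= max_family k ->
  exists F, nodes F = n /\ minn n (deg F + 2 * ht F - 2) <= k.
Proof.
have all_short (d w : nat) : n <= d * max_tree w -> (0 < w -> d + 2 * w - 2 <= k) ->
    exists F, nodes F = n /\ minn n (deg F + 2 * ht F - 2) <= k.
  case: w => [|w] le => [_|/(_ isT) dk].
    by exists Nil; move: le; rewrite (_ : max_tree 0 = 0) //=; lia.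
  have [//|F [nF dF hF]] := forest_of_size le.
  by exists F; split => //; lia.
rewrite {1}/max_family leq_max => /orP[nk|].
  have [|//|F [nF _ _]] := @forest_of_size n 1 n.
    by rewrite (_ : max_tree 1 = 1) ?muln1.
  by exists F; split => //; lia.
have := odd_double_half k; move: (k./2) => w.
by case: (odd k) => /= Ek; rewrite leq_max => /orP[] /all_short; apply; lia.
Qed.

Lemma layout_shift k o F :
  layout (k + o) F = [seq (k + c.1, k + c.2) | c <- layout o F].
Proof.
elim: F o => //= f IHf g IHg o.
by rewrite map_cat -IHf -IHg /= (addnS k o) !addnA.
Qed.

(* Rotating the forest by one step moves every point [i.+1] to [i] and the
   point [0] to the last position. *)
Definition unrot N i := if i.+1 == N then 0 else i.+1.

Lemma layout_rotF F : let r e := (unrot (2 * nodes F) e.1, unrot (2 * nodes F) e.2) in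
  (forall e, e \in layout 0 (rotF F) -> oriented (layout 0 F) (r e)) /\
  (forall e, e \in layout 0 F ->
     exists2 d, d \in layout 0 (rotF F) & r d = e \/ r d = swap e).
Proof.
case: F => [|f g] /=; first by split.
rewrite layout_fcat /= cats0 add0n.
have Ef : layout 1 f = [seq (1 + c.1, 1 + c.2) | c <- layout 0 f].
  by rewrite -layout_shift.
have Eg : layout (2 * nodes f).+2 g =
    [seq (1 + c.1, 1 + c.2) | c <- layout (2 * nodes f).+1 g].
  by rewrite -layout_shift.
rewrite add0n Ef Eg.
have r1 i : i < (2 * (nodes f + nodes g)).+1 -> unrot (2 * (nodes f + nodes g).+1) i = 1 + i.
  by rewrite /unrot; case: eqP; lia.
have r2 : unrot (2 * (nodes f + nodes g).+1) (2 * nodes f + (2 * nodes g).+1) = 0.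
  by rewrite /unrot; case: eqP; lia.
split=> [e|e].
  rewrite mem_cat inE /oriented /swap => /or3P[ef|/eqP->|eg] /=.
  - have := layout_bounds ef => ?; rewrite !r1; try lia.
    by rewrite !inE !mem_cat (map_f (fun c => (1 + c.1, 1 + c.2)) ef) !orbT.
  - rewrite r2 r1; last by lia.
    by rewrite !inE add1n eqxx !orbT.
  - have := layout_bounds eg => ?; rewrite !r1; try lia.
    by rewrite !inE !mem_cat (map_f (fun c => (1 + c.1, 1 + c.2)) eg) !orbT.
rewrite inE mem_cat => /or3P[/eqP->|/mapP[d df ->]|/mapP[d dg ->]].
- exists (2 * nodes f, 2 * nodes f + (2 * nodes g).+1).
    by rewrite mem_cat inE eqxx orbT.
  by right; rewrite /= r2 r1 //; lia.
- exists d; first by rewrite mem_cat df.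
  by left; have := layout_bounds df => ? /=; rewrite !r1 //; lia.
- exists d; first by rewrite mem_cat inE dg !orbT.
  by left; have := layout_bounds dg => ? /=; rewrite !r1 //; lia.
Qed.

Lemma size_pts s : size (pts s) = 2 * size s.
Proof. by elim: s => [//|c s IH]; rewrite pts_cons /= IH; lia. Qed.

Lemma nth_pts s i : i < size s ->
  nth 0 (pts s) i.*2 = (nth (0, 0) s i).1 /\
  nth 0 (pts s) i.*2.+1 = (nth (0, 0) s i).2.
Proof. by elim: s i => //= c s IH [|i] //=; rewrite ltnS => /IH. Qed.

Lemma size_links x s : size (links x s) = size s.
Proof. by elim: s x => //= c s IH x; rewrite IH. Qed.

Lemma nth_inner_links s i : i.+1 < size s ->
  nth (0, 0) (inner_links s) i = ((nth (0, 0) s i).2, (nth (0, 0) s i.+1).1).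
Proof.
case: s => //= c s; elim: s i c => //= d s IH [|i] c //=; rewrite ltnS.
exact: IH.
Qed.

Lemma size_inner_links s : size (inner_links s) = (size s).-1.
Proof. by case: s => //= c s; rewrite size_links. Qed.

Lemma cross_swap1 e l : cross (swap e) l = cross e l.
Proof. by case: e => a b; rewrite crossC1. Qed.

Lemma layout_cross o F e d : e \in layout o F -> d \in layout o F -> ~~ cross e d.
Proof.
move=> eF dF; have := layout_bounds eF; have := layout_bounds dF.
by case: (layout_tri eF dF) => [->||]; rewrite /inside /outside /cross /between /beyond;
  clear; lia.
Qed.

Lemma oriented_cross o F e d : oriented (layout o F) e -> d \in layout o F -> ~~ cross e d.
Proof.
by case/orP => /layout_cross/[apply]; rewrite ?cross_swap1.
Qed.

Lemma layout_share o F e d (x : nat) : e \in layout o F -> d \in layout o F ->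
  x = e.1 \/ x = e.2 -> x = d.1 \/ x = d.2 -> e = d.
Proof.
move=> eF dF; have := layout_bounds eF; have := layout_bounds dF.
by case: (layout_tri eF dF) => [->//||]; rewrite /inside /outside; clear; lia.
Qed.

Lemma orientedP M (a b : nat) : oriented M (a, b) <->
  exists2 c, c \in M & (a, b) = (c.1, c.2) \/ (a, b) = (c.2, c.1).
Proof.
split=> [/orP[]abM|[c cM [[-> ->]|[-> ->]]]].
- by exists (a, b); [|left].
- by exists (b, a); [|right].
- by rewrite /oriented -surjective_pairing cM.
- by rewrite /oriented /swap -surjective_pairing cM orbT.
Qed.

(** * The chain as a sequence of labels: even edges are chords, odd edges are links *)

Section Vertices.
Variables (F : forest) (s : seq (nat * nat)).
Hypothesis sa : alternating (layout 0 F) s.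
Let M := layout 0 F.
Let x i := nth 0 (pts s) i.

Lemma vertex_bound i : i < 2 * size s -> x i < 2 * nodes F.
Proof.
move=> ilt; case: sa => so _ _ _.
have := @oriented_bounds 0 F s (x i) so; rewrite add0n => /(_ _)/andP[]//.
by apply: mem_nth; rewrite size_pts.
Qed.

Lemma vertex_inj i j : i < 2 * size s -> j < 2 * size s -> x i = x j -> i = j.
Proof.
move=> ilt jlt /eqP; case: sa => _ us _ _.
by rewrite nth_uniq ?size_pts // => /eqP.
Qed.

Lemma even_edge i : i.+1 < 2 * size s -> ~~ odd i ->
  (x i, x i.+1) \in s.
Proof.
move=> ilt ei; have lt : i./2 < size s by lia.
have [e1 e2] := nth_pts lt; move: e1 e2; rewrite (_ : i./2.*2 = i); last by lia.
by rewrite /x => -> ->; rewrite -surjective_pairing; apply: mem_nth.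
Qed.

Lemma odd_edge i : i.+1 < 2 * size s -> odd i ->
  nth (0, 0) (inner_links s) i./2 = (x i, x i.+1) /\ i./2 < size (inner_links s).
Proof.
move=> ilt oi; rewrite size_inner_links; split; last by lia.
rewrite nth_inner_links; last by lia.
have [|_ e1] := @nth_pts s i./2; first by lia.
have [|e2 _] := @nth_pts s i./2.+1; first by lia.
rewrite -e1 -e2 /x; congr (nth _ _ _, nth _ _ _); lia.
Qed.

Lemma odd_edge_cross i e : i.+1 < 2 * size s -> odd i -> e \in M ->
  ~~ cross e (x i, x i.+1).
Proof.
move=> ilt oi eM; case: sa => _ _ sM _; apply: sM eM.
by have [<- lt] := odd_edge ilt oi; apply: mem_nth.
Qed.

Lemma even_edge_oriented i : i.+1 < 2 * size s -> ~~ odd i -> oriented M (x i, x i.+1).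
Proof. by case: sa => so _ _ _ ilt oi; apply: so; apply: even_edge. Qed.

Lemma oriented_odd_cross i j : i.+1 < 2 * size s -> ~~ odd i ->
  j.+1 < 2 * size s -> odd j -> ~~ cross (x i, x i.+1) (x j, x j.+1).
Proof.
move=> ilt ei jlt oj; case/orP: (even_edge_oriented ilt ei) => /(odd_edge_cross jlt oj) //.
by rewrite cross_swap1.
Qed.

Lemma edges_cross i j : i < j -> j.+1 < 2 * size s ->
  ~~ cross (x i, x i.+1) (x j, x j.+1).
Proof.
move=> ij jlt; have ilt : i.+1 < 2 * size s by apply: ltn_trans jlt.
case: (boolP (odd i)) => oi; case: (boolP (odd j)) => oj; last first.
- have := even_edge_oriented ilt oi; case/orP: (even_edge_oriented jlt oj) => jM iM.
    exact: oriented_cross iM jM.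
  by have := oriented_cross iM jM; rewrite cross_sym cross_swap1 cross_sym.
- exact: oriented_odd_cross.
- by rewrite cross_sym; apply: oriented_odd_cross.
case: sa => _ _ _ /(pairwiseP (0,0)) sn.
have [<- li] := odd_edge ilt oi; have [<- lj] := odd_edge jlt oj.
by apply: sn => //; lia.
Qed.

Lemma vertex_chord i : i < 2 * size s -> exists c,
  [/\ c \in M, x i = c.1 \/ x i = c.2 & c \in s \/ swap c \in s].
Proof.
move=> ilt; case: sa => so _ _ _.
have lt : i./2 < size s by lia.
have [e1 e2] := nth_pts lt.
set c := nth (0, 0) s _ in e1 e2; have cs : c \in s by apply: mem_nth.
have xc : x i = c.1 \/ x i = c.2.
  case: (boolP (odd i)) => oi; [right|left]; rewrite -?e1 -?e2 /x; congr (nth _ _ _); lia.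
case/orP: (so c cs) => cM; first by exists c; split => //; left.
exists (swap c); split => //; first by case: xc; [right|left].
by right; case: c cs {e1 e2 xc cM}.
Qed.

(** The start of a link already ends the preceding chord of the chain. As chords share no endpoint,
    the link would be that same chord and a vertex would repeat. *)
Lemma odd_edge_not_chord i : i.+1 < 2 * size s -> odd i -> ~~ oriented M (x i, x i.+1).
Proof.
move=> ilt oi; apply/negP => io.
case: i => // i in ilt oi io *.
have ei : ~~ odd i by move: oi.
have ilt' : i.+1 < 2 * size s by apply: ltn_trans ilt.
have [c cM cx] := (orientedP _ _ _).1 (even_edge_oriented ilt' ei).
have [d dM dx] := (orientedP _ _ _).1 io.
have E : c = d.
  apply: (layout_share (x := x i.+1) cM dM).
    by case: cx => -[_ ->]; [right|left].
  by case: dx => -[-> _]; [left|right].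
have : x i.+2 = x i \/ x i.+2 = x i.+1.
  rewrite E in cx.
  by case: cx dx => -[e1 e2] [] [e3 e4]; rewrite e1 e2 e4; auto.
by case => /vertex_inj; move: ilt; clear; lia.
Qed.
End Vertices.

End Forests.

Import Order.TTheory GRing.Theory Num.Theory.

(** * The closed formula *)

Lemma max_tree_geq h : h <= max_tree h.
Proof.
by elim: h => // h IH; have := @max_tree_node 1 h isT; rewrite mul1n add1n; lia.
Qed.

Lemma max_family_odd w : 6 <= w -> max_family (2 * w).+3 = 5 * max_tree w.
Proof.
move=> w6; apply/eqP; rewrite eqn_leq max_family_ge5 andbT.
rewrite /max_family /= mul2n odd_double /= uphalf_double /=.
have := max_tree_ratio53 (leq_trans (isT : 3 <= 6) w6); have := max_tree_geq w.
by lia.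
Qed.

Lemma max_family_even w : 6 <= w -> max_family (2 * w).+4 = 6 * max_tree w.
Proof.
move=> w6; apply/eqP; rewrite eqn_leq max_family_ge6 andbT.
rewrite /max_family /= mul2n odd_double /= half_double /=.
by have := max_tree_ratio32 w6; have := max_tree_geq w; lia.
Qed.

(** The map from [m] to [3 * m + 1] triples [2 * m + 1]. *)
Lemma max_tree_closed (h c i : nat) : 6 <= h -> 2 * max_tree h + 1 = c ->
  2 * max_tree (h + 3 * i) + 1 = c * 3 ^ i.
Proof.
move=> h6 <-; elim: i => [|i IH]; first by rewrite muln0 addn0 muln1.
rewrite expnS mulnCA -IH (_ : h + 3 * i.+1 = (h + 3 * i).+3); last by lia.
by rewrite max_tree_rec; lia.
Qed.

Section Formulas.
Local Open Scope ring_scope.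
Variable R : realType.
Implicit Types (x y : R).

Lemma sixfloorE x : exists2 v : int, sixfloor x = 6 * v &
  forall j : int, (j <= v) = (6 * j%:~R - 1 < x).
Proof.
exists (Num.floor (6^-1 * (Num.ceil x)%:~R : R)) => // j.
rewrite floor_ge_int (_ : (_ <= _) = (6 * j%:~R <= (Num.ceil x)%:~R :> R)); last first.
  by apply/idP/idP; lra.
have -> : 6 * j%:~R = (6 * j)%:~R :> R by rewrite intrM.
rewrite ler_int (_ : (_ <= _) = (6 * j - 1 < Num.ceil x)%R); last by lia.
by rewrite ceil_gt_int intrB.
Qed.

(* The point where [6 * floor (ceil (6 log_3 y + 6e - 1) / 6)] reaches [6 * j]. *)
Lemma sixfloor_log3 y (e : nat) (c : R) : 0 < y -> c = 6 * e%:R - 1 ->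
  exists2 v : int, sixfloor (6 * log3 y + c) = 6 * v &
  forall j : nat, (e <= j)%N -> (j%:Z <= v) = (3 ^+ (j - e) < y).
Proof.
move=> y0 ->; have [v -> vE] := sixfloorE (6 * log3 y + (6 * e%:R - 1)).
exists v => // j ej; rewrite vE.
have l3 : 0 < ln (3 : R) by apply: ln_gt0; lra.
have -> : (3 ^+ (j - e) < y) = ((j - e)%N%:R * ln 3 < ln y).
  by rewrite mulr_natl -lnXn ?ltr_ln ?posrE ?exprn_gt0 //; lra.
rewrite natrB // -ltr_pdivlMr // -/(log3 y) -pmulrn.
by apply/idP/idP; lra.
Qed.

(** [max_family (6 * j + r).-1 < n] says that the value at [n] is at least [6 * j + r]. So [q], when
    it is at least 18, is the largest such number congruent to [r] modulo 6. The restriction to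
    [3 <= j] keeps the branch heights in the range of the closed formulas. *)
Definition attains n (r : nat) (q : int) := exists2 v : int, q = 6 * v + r%:Z &
  forall j : nat, (3 <= j)%N -> (j%:Z <= v) = (max_family (6 * j + r).-1 < n)%N.

(** Here [b] is the root degree and [a] the size of a branch. After multiplication by [b * C] the
    inequality reads [b * (2 * a + 1) < 2 * n + b]. *)
Lemma pow3_lt (e j a b C n : nat) y : (e <= j)%N ->
  (2 * a + 1 = C * 3 ^ (j - e))%N ->
  (0 < C)%N -> y = (2 * n%:R + b%:R) / (b * C)%:R -> (0 < b)%N ->
  (3 ^+ (j - e) < y) = (b * a < n)%N.
Proof.
move=> ej aE C0 -> b0.
have C0' : 0 < (C%:R : R) by rewrite ltr0n.
have b0' : 0 < (b%:R : R) by rewrite ltr0n.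
rewrite ltr_pdivlMr ?natrM ?mulr_gt0 //.
have -> : 3 ^+ (j - e) * (b%:R * C%:R) = (b * (2 * a + 1))%N%:R :> R.
  by rewrite aE !natrM natrX; ring.
rewrite -natrM -natrD ltr_nat; lia.
Qed.

Lemma attains_sixfloor n (r e b C : nat) (w : nat -> nat) (y c : R) :
  (0 < b)%N -> (0 < C)%N -> (e <= 3)%N ->
  (forall j, (3 <= j)%N -> max_family (6 * j + r).-1 = b * max_tree (w j))%N ->
  (forall j, (3 <= j)%N -> 2 * max_tree (w j) + 1 = C * 3 ^ (j - e))%N ->
  y = (2 * n%:R + b%:R) / (b * C)%:R -> c = 6 * e%:R - 1 ->
  attains n r (sixfloor (6 * log3 y + c) + r%:Z).
Proof.
move=> b0 C0 e3 fE tE yE cE.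
have y0 : 0 < y.
  by rewrite yE divr_gt0 ?ltr0n ?muln_gt0 ?b0 // -natrM -natrD ltr0n; lia.
have [v -> vE] := sixfloor_log3 y0 cE.
exists v => // j j3; rewrite vE ?fE //; last exact: leq_trans j3.
by apply: pow3_lt (tE j j3) C0 yE b0; apply: leq_trans j3.
Qed.

(** The value 33 at height 7 is written 11 * 3, so that the exponent is [j - 2] and the formula has
    11 as its constant. *)
Let tree1 j : (3 <= j)%N -> (2 * max_tree (3 * j - 2) + 1 = 11 * 3 ^ (j - 2))%N.
Proof.
move=> j3; rewrite (_ : 3 * j - 2 = 7 + 3 * (j - 3))%N; last by lia.
rewrite (@max_tree_closed 7 33) // (_ : j - 2 = (j - 3).+1)%N; last by lia.
by rewrite expnS mulnA.
Qed.

Let tree2 j : (3 <= j)%N -> (2 * max_tree (3 * j - 1) + 1 = 47 * 3 ^ (j - 3))%N.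
Proof.
move=> j3; rewrite (_ : 3 * j - 1 = 8 + 3 * (j - 3))%N; last by lia.
by rewrite (@max_tree_closed 8 47).
Qed.

Let tree3 j : (3 <= j)%N -> (2 * max_tree (3 * j) + 1 = 23 * 3 ^ (j - 2))%N.
Proof.
move=> j3; rewrite (_ : 3 * j = 6 + 3 * (j - 2))%N; last by lia.
by rewrite (@max_tree_closed 6 23).
Qed.

Let odd_step k w : (6 <= w)%N -> k = (2 * w).+3 -> max_family k = (5 * max_tree w)%N.
Proof. by move=> w6 ->; apply: max_family_odd. Qed.

Let even_step k w : (6 <= w)%N -> k = (2 * w).+4 -> max_family k = (6 * max_tree w)%N.
Proof. by move=> w6 ->; apply: max_family_even. Qed.

Lemma attains_q0 n : attains n 0 (q0 R n).
Proof.
rewrite /q0 -[X in attains _ _ X]addr0.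
apply: (@attains_sixfloor n 0 2 5 11 (fun j => 3 * j - 2)%N) => //.
- by move=> j j3; apply: odd_step; lia.
- by rewrite natrM; field.
- by lra.
Qed.

Lemma attains_q1 n : attains n 1 (q1 R n).
Proof.
apply: (@attains_sixfloor n 1 2 6 11 (fun j => 3 * j - 2)%N) => //.
- by move=> j j3; apply: even_step; lia.
- by rewrite natrM; field.
- by lra.
Qed.

Lemma attains_q2 n : attains n 2 (q2 R n).
Proof.
apply: (@attains_sixfloor n 2 3 5 47 (fun j => 3 * j - 1)%N) => //.
- by move=> j j3; apply: odd_step; lia.
- by rewrite natrM; field.
- by lra.
Qed.

Lemma attains_q3 n : attains n 3 (q3 R n).
Proof.
apply: (@attains_sixfloor n 3 3 6 47 (fun j => 3 * j - 1)%N) => //.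
- by move=> j j3; apply: even_step; lia.
- by rewrite natrM; field.
- by lra.
Qed.

Lemma attains_q4 n : attains n 4 (q4 R n).
Proof.
apply: (@attains_sixfloor n 4 2 5 23 (fun j => 3 * j)%N) => //.
- by move=> j j3; apply: odd_step; lia.
- by rewrite natrM; field.
- by lra.
Qed.

Lemma attains_q5 n : attains n 5 (q5 R n).
Proof.
apply: (@attains_sixfloor n 5 2 6 23 (fun j => 3 * j)%N) => //.
- by move=> j j3; apply: even_step; lia.
- by rewrite natrM; field.
- by lra.
Qed.

Lemma attains_le n k r q : attains n r q -> (r < 6)%N -> (22 <= k)%N ->
  (n <= max_family k)%N -> q <= k%:Z.
Proof.
move=> [v -> vE] r6 k22 nk; rewrite leNgt; apply/negP => lt.
have v3 : (3 <= v) by lia.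
case: v v3 vE lt => // j j3 vE lt.
have : (max_family (6 * j + r).-1 < n)%N by rewrite -vE.
rewrite ltnNge => /negP; apply; apply: leq_trans nk _.
by apply: max_family_mono; lia.
Qed.

Lemma attains_ge n k q : attains n (k %% 6) q -> (22 <= k)%N ->
  (max_family k.-1 < n)%N -> k%:Z <= q.
Proof.
move=> [v -> vE] k22 nk.
have E : (6 * (k %/ 6) + k %% 6 = k)%N by rewrite mulnC -divn_eq.
have d3 : (3 <= k %/ 6)%N by rewrite leq_divRL //; apply: leq_trans k22.
have : ((k %/ 6)%N%:Z <= v) by rewrite vE // E.
rewrite -[X in X%:Z <= 6 * v + _]E PoszD PoszM => le.
by rewrite lerD2r ler_pM2l.
Qed.

(** All six numbers are at most [k], and the one whose index is [k] modulo 6 reaches it. *)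
Lemma q_formula n k : (171 <= n)%N -> (max_family k.-1 < n <= max_family k)%N ->
  k%:Z = Num.max (q0 R n) (Num.max (q1 R n) (Num.max (q2 R n)
           (Num.max (q3 R n) (Num.max (q4 R n) (q5 R n))))).
Proof.
move=> n171 /andP[nk kn].
(* [max_family 21] is 170. *)
have k22 : (22 <= k)%N.
  rewrite leqNgt; apply/negP => k22.
  have /(_ k22) le := leq_trans kn (max_family_mono (_ : k <= 21)%N).
  by have := leq_trans n171 le.
apply/eqP; rewrite eq_le !ge_max; apply/andP; split; last first.
  rewrite (attains_le (attains_q0 n) isT k22 kn) (attains_le (attains_q1 n) isT k22 kn).
  rewrite (attains_le (attains_q2 n) isT k22 kn) (attains_le (attains_q3 n) isT k22 kn).
  by rewrite (attains_le (attains_q4 n) isT k22 kn) (attains_le (attains_q5 n) isT k22 kn).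
have ge q : attains n (k %% 6) q -> k%:Z <= q by move/attains_ge; apply.
rewrite !le_max; move: ge (ltn_pmod k (isT : 0 < 6)%N).
case: (k %% 6)%N => [|[|[|[|[|[|//]]]]]] ge _.
- by rewrite (ge _ (attains_q0 n)).
- by rewrite (ge _ (attains_q1 n)) !orbT.
- by rewrite (ge _ (attains_q2 n)) !orbT.
- by rewrite (ge _ (attains_q3 n)) !orbT.
- by rewrite (ge _ (attains_q4 n)) !orbT.
- by rewrite (ge _ (attains_q5 n)) !orbT.
Qed.
End Formulas.

(** * Segments between points of a convex curve *)

Section Plane.
Local Open Scope classical_set_scope.
Local Open Scope ring_scope.
Variable R : realType.
Local Notation point := 'rV[R]_2.
Implicit Types (a b c d : point) (t : R).

Definition orient a b c : R :=
  (b 0 0 - a 0 0) * (c 0 1 - a 0 1) - (b 0 1 - a 0 1) * (c 0 0 - a 0 0).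

Lemma point_eq a b : a 0 0 = b 0 0 -> a 0 1 = b 0 1 -> a = b.
Proof.
move=> e0 e1; apply/rowP => -[[|[|//]] i2].
- by rewrite (_ : Ordinal i2 = 0) //; apply: val_inj.
- by rewrite (_ : Ordinal i2 = 1) //; apply: val_inj.
Qed.

Lemma orient_conv a b c d t :
  orient a b ((1 - t) *: c + t *: d) = (1 - t) * orient a b c + t * orient a b d.
Proof. by rewrite /orient !mxE; ring. Qed.

Lemma orientC a b c : orient b a c = - orient a b c.
Proof. by rewrite /orient; ring. Qed.

Lemma orient_rot a b c : orient b c a = orient a b c.
Proof. by rewrite /orient; ring. Qed.

Lemma orientxx a b : orient a b a = 0 /\ orient a b b = 0.
Proof. by rewrite /orient; split; ring. Qed.

Lemma segmentP a b p :
  segment a b p <-> exists t, [/\ 0 <= t, t <= 1 & p = (1 - t) *: a + t *: b].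
Proof.
split=> [[t /= + <-]|[t [t0 t1 ->]]].
  by rewrite in_itv /= => /andP[t0 t1]; exists t.
by exists t => //; rewrite /= in_itv /= t0.
Qed.

Lemma open_segmentP a b p :
  open_segment a b p <-> exists t, [/\ 0 < t, t < 1 & p = (1 - t) *: a + t *: b].
Proof.
split=> [[t /= + <-]|[t [t0 t1 ->]]].
  by rewrite in_itv /= => /andP[t0 t1]; exists t.
by exists t => //; rewrite /= in_itv /= t0.
Qed.

Lemma segmentC a b : segment a b = segment b a.
Proof.
wlog suff : a b / segment a b `<=` segment b a.
  by move=> H; apply/seteqP; split; apply: H.
move=> _ /segmentP[t [t0 t1 ->]]; apply/segmentP; exists (1 - t).
by split; [lra|lra|rewrite subKr addrC].
Qed.

Lemma segment_l a b : segment a b a.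
Proof.
by apply/segmentP; exists 0; split; rewrite ?ler01 // subr0 scale1r scale0r addr0.
Qed.

Lemma segment_r a b : segment a b b.
Proof. by rewrite segmentC; exact: segment_l. Qed.

Lemma open_segment_sub a b : open_segment a b `<=` segment a b.
Proof.
move=> _ /open_segmentP[t [t0 t1 ->]]; apply/segmentP; exists t.
by split => //; apply: ltW.
Qed.

Lemma orient_segment a b p : segment a b p -> orient a b p = 0.
Proof.
by move=> [t _ <-]; rewrite orient_conv (orientxx a b).1 (orientxx a b).2; ring.
Qed.

Definition same_side a b c d :=
  (0 < orient a b c /\ 0 < orient a b d) \/ (orient a b c < 0 /\ orient a b d < 0).

Definition opposite_sides a b c d :=
  (0 < orient a b c /\ orient a b d < 0) \/ (orient a b c < 0 /\ 0 < orient a b d).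

Lemma orient_segment_neq a b c d p : same_side a b c d ->
  segment c d p -> orient a b p != 0.
Proof.
move=> pos [t /= + <-]; rewrite in_itv /= orient_conv => /andP[t0 t1].
apply/eqP => E; case: pos => -[]; nra.
Qed.

Lemma disjoint_segments a b c d : same_side a b c d ->
  segment a b `&` segment c d = set0.
Proof.
move=> ss; apply/seteqP; split => // p [/orient_segment p0 /(orient_segment_neq ss)].
by rewrite p0 eqxx.
Qed.

Lemma adjacent_segments a b c : orient a b c != 0 ->
  segment a b `&` segment b c = [set b].
Proof.
move=> nz; apply/seteqP; split => [p [/orient_segment + [t _ tp]]|_ ->].
  rewrite -tp orient_conv (orientxx a b).2 mulr0 add0r => /eqP.
  rewrite mulf_eq0 (negPf nz) orbF => /eqP ->.
  by rewrite subr0 scale1r scale0r addr0.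
by split; [exact: segment_r|exact: segment_l].
Qed.

(** Along each segment, the signed area with respect to the other one is affine and changes sign;
    its zero gives the parameter of the common point. *)
Lemma crossing_segments a b c d : opposite_sides a b c d -> opposite_sides c d a b ->
  open_segment a b `&` open_segment c d !=set0.
Proof.
move=> oab ocd.
set al := orient c d a; set be := orient c d b.
set ga := orient a b c; set de := orient a b d.
have E : al - be = - (ga - de) by rewrite /al /be /ga /de /orient; ring.
have abn : al - be != 0 by case: ocd; rewrite -/al -/be => -[? ?]; apply/eqP; lra.
have gdn : ga - de != 0 by apply: contra abn => /eqP g0; rewrite E g0 oppr0.
have in01 (u v : R) : 0 < u /\ v < 0 \/ u < 0 /\ 0 < v -> 0 < u / (u - v) < 1.
  case=> -[u0 v0].
    have uv : 0 < u - v by lra.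
    by rewrite divr_gt0 // ltr_pdivrMr //; lra.
  have -> : u / (u - v) = (- u) / (v - u).
    by field; rewrite ?subr_eq0; apply/andP; split; apply/eqP; lra.
  have uv : 0 < v - u by lra.
  by rewrite divr_gt0 ?ltr_pdivrMr //; lra.
have aD : al / (al - be) = - al / (ga - de) by rewrite E invrN mulrN mulNr.
exists ((1 - al / (al - be)) *: a + (al / (al - be)) *: b); split.
  by apply/open_segmentP; exists (al / (al - be)); have /andP[] := in01 _ _ ocd.
apply/open_segmentP; exists (ga / (ga - de)); have /andP[? ?] := in01 _ _ oab; split => //.
have key (u v w z : R) : (ga - de) * u - al * (v - u) = (ga - de) * w + ga * (z - w) ->
    (1 - - al / (ga - de)) * u + - al / (ga - de) * v =
    (1 - ga / (ga - de)) * w + ga / (ga - de) * z.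
  move=> e; apply: (mulfI gdn); rewrite -[LHS](_ : (ga - de) * u - al * (v - u) = _).
    by rewrite e; field.
  by field.
rewrite aD; apply: point_eq; rewrite !mxE; apply: key; rewrite /al /be /ga /de /orient; ring.
Qed.

(** Counterclockwise labelling of a convex polygon. Distinctness is a separate clause because the
    orientation clause is empty for two points, the case of a single segment. *)
Definition convex_curve (P : nat -> point) (N : nat) :=
  (forall i j, (i < j < N)%N -> P i <> P j) /\
  (forall i j k, (i < j)%N -> (j < k)%N -> (k < N)%N -> 0 < orient (P i) (P j) (P k)).

Section Curve.
Variables (P : nat -> point) (N : nat).
Hypothesis PN : convex_curve P N.
Implicit Types i j k l : nat.

Lemma curve_inj i j : (i < N)%N -> (j < N)%N -> P i = P j -> i = j.
Proof.
move=> iN jN E; case: (ltngtP i j) => // ij; exfalso.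
- by have := PN.1 i j; rewrite ij jN => /(_ isT) /(_ E).
- by have := PN.1 j i; rewrite ij iN => /(_ isT) /(_ (esym E)).
Qed.

Lemma curve_between i j k : (i < N)%N -> (j < N)%N -> (i < k < j)%N ->
  orient (P i) (P j) (P k) < 0.
Proof.
move=> iN jN /andP[ik kj]; rewrite -orient_rot orientC oppr_lt0 orient_rot -orient_rot.
by have := PN.2 i k j ik kj jN; rewrite -orient_rot.
Qed.

Lemma curve_beyond i j k : (i < j < N)%N -> (k < N)%N -> (k < i)%N || (j < k)%N ->
  0 < orient (P i) (P j) (P k).
Proof.
move=> /andP[ij jN] kN /orP[ki|jk]; last exact: PN.2.
by rewrite orient_rot; exact: PN.2.
Qed.

Lemma curve_same_side i j k l : (i < N)%N -> (j < N)%N -> (k < N)%N -> (l < N)%N ->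
  i != j -> k != i -> k != j -> l != i -> l != j -> ~~ cross (i, j) (k, l) ->
  same_side (P i) (P j) (P k) (P l).
Proof.
wlog ij : i j / (i < j)%N => [H|] iN jN kN lN nij ki kj li lj nc.
  have [ij|ji|E] := ltngtP i j; first exact: H.
    rewrite eq_sym in nij; rewrite crossC1 in nc.
    have := H j i ji jN iN kN lN nij kj ki lj li nc.
    rewrite /same_side ![orient (P j) (P i) _]orientC !oppr_gt0 !oppr_lt0.
    by case; [right|left].
  by rewrite E eqxx in nij.
move: nc; rewrite /cross /between /beyond /= => nc.
have : (i < k < j)%N /\ (i < l < j)%N \/
  ((k < i)%N || (j < k)%N) /\ ((l < i)%N || (j < l)%N).
  by clear -ij nij ki kj li lj nc; lia.
case=> -[kk ll]; first by right; split; apply: curve_between.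
by left; split; apply: curve_beyond => //; rewrite ij.
Qed.

Lemma curve_opposite i j k l : (i < N)%N -> (j < N)%N -> (k < N)%N -> (l < N)%N ->
  cross (i, j) (k, l) -> opposite_sides (P i) (P j) (P k) (P l).
Proof.
wlog ij : i j / (i < j)%N => [H|] iN jN kN lN nc.
  case: (ltngtP i j) => [ij|ij|E]; first exact: H.
    have := H j i ij jN iN kN lN; rewrite crossC1 => /(_ nc).
    rewrite /opposite_sides ![orient (P i) (P j) _]orientC !oppr_gt0 !oppr_lt0.
    by case; [right|left].
  by move: nc; rewrite E /cross /between /beyond /=; clear; lia.
move: nc; rewrite /cross /between /beyond /= => nc.
have : (i < k < j)%N /\ ((l < i)%N || (j < l)%N) \/
  ((k < i)%N || (j < k)%N) /\ (i < l < j)%N.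
  by clear -ij nc; lia.
case=> -[kk ll]; [right|left]; split;
  by [apply: curve_between|apply: curve_beyond => //; rewrite ij].
Qed.

Lemma curve_disjoint i j k l : (i < N)%N -> (j < N)%N -> (k < N)%N -> (l < N)%N ->
  i != j -> k != i -> k != j -> l != i -> l != j -> ~~ cross (i, j) (k, l) ->
  segment (P i) (P j) `&` segment (P k) (P l) = set0.
Proof. by move=> *; apply/disjoint_segments/curve_same_side. Qed.

Lemma curve_meet i j k l : (i < N)%N -> (j < N)%N -> (k < N)%N -> (l < N)%N ->
  cross (i, j) (k, l) ->
  open_segment (P i) (P j) `&` open_segment (P k) (P l) !=set0.
Proof.
move=> iN jN kN lN c; apply: crossing_segments; apply: curve_opposite => //.
by rewrite cross_sym.
Qed.

Lemma curve_orient_neq i j k : (i < N)%N -> (j < N)%N -> (k < N)%N ->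
  i != j -> k != i -> k != j -> orient (P i) (P j) (P k) != 0.
Proof.
move=> iN jN kN ij ki kj.
have : ~~ cross (i, j) (k, k) by rewrite /cross /between /beyond /=; clear; lia.
by move=> /(curve_same_side iN jN kN kN ij ki kj ki kj) [] [? _]; apply/eqP; lra.
Qed.

Lemma curve_adjacent i j k : (i < N)%N -> (j < N)%N -> (k < N)%N ->
  i != j -> k != i -> k != j ->
  segment (P i) (P j) `&` segment (P j) (P k) = [set P j].
Proof. by move=> *; apply/adjacent_segments/curve_orient_neq. Qed.

End Curve.

(** With [s], [t] the parameters of [p], [q] on the segment from [a] to [b], both 0 and 1 are convex
    combinations of [s] and [t] in the unit interval, so these are 0 and 1 in some order. *)
Lemma segment_ends a b p q : segment p q = segment a b ->
  (p = a /\ q = b) \/ (p = b /\ q = a).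
Proof.
move=> E.
have [s [s0 s1 ps]] : exists t, [/\ 0 <= t, t <= 1 & p = (1 - t) *: a + t *: b].
  by apply/segmentP; rewrite -E; exact: segment_l.
have [t [t0 t1 qt]] : exists t, [/\ 0 <= t, t <= 1 & q = (1 - t) *: a + t *: b].
  by apply/segmentP; rewrite -E; exact: segment_r.
have [u [u0 u1 au]] : exists t, [/\ 0 <= t, t <= 1 & a = (1 - t) *: p + t *: q].
  by apply/segmentP; rewrite E; exact: segment_l.
have [v [v0 v1 bv]] : exists t, [/\ 0 <= t, t <= 1 & b = (1 - t) *: p + t *: q].
  by apply/segmentP; rewrite E; exact: segment_r.
have [ab|ab] := eqVneq a b.
  by left; rewrite ps qt -ab -!scalerDl !subrK !scale1r.
have za : ((1 - u) * s + u * t) *: (b - a) = 0.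
  apply/eqP; rewrite -(inj_eq (addrI a)) addr0; apply/eqP.
  by rewrite [RHS]au ps qt; apply/rowP => i; rewrite !mxE; ring.
have zb : ((1 - v) * s + v * t - 1) *: (b - a) = 0.
  apply/eqP; rewrite -(inj_eq (addrI b)) addr0; apply/eqP.
  by rewrite [RHS]bv ps qt; apply/rowP => i; rewrite !mxE; ring.
have {}za : (1 - u) * s + u * t = 0.
  by move/eqP: za; rewrite scaler_eq0 subr_eq0 (eq_sym b) (negPf ab) orbF => /eqP.
have {}zb : (1 - v) * s + v * t = 1.
  by move/eqP: zb; rewrite scaler_eq0 !subr_eq0 (eq_sym b) (negPf ab) orbF => /eqP.
have : (s = 0 /\ t = 1) \/ (s = 1 /\ t = 0).
  have [sz|sz] := eqVneq s 0; first by left; split => //; nra.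
  have u1' : u = 1 by nra.
  by right; split; nra.
by case=> -[Es Et]; [left|right]; rewrite ps qt Es Et ?subr0 ?subrr ?scale1r ?scale0r ?addr0 ?add0r.
Qed.

End Plane.

(** * Labelling points in convex position along a convex curve *)

Section Position.
Local Open Scope classical_set_scope.
Local Open Scope ring_scope.
Variable R : realType.
Local Notation point := 'rV[R]_2.
Implicit Types (a b c d : point).

Lemma convex_set_comb (C : set point) a b (t : R) :
  @convex_set R point C -> C a -> C b -> 0 <= t -> t <= 1 ->
  C ((1 - t) *: a + t *: b).
Proof.
move=> cC Ca Cb t0 t1.
have := cC b a (Itv01 t0 t1); rewrite !inE => /(_ Cb Ca).
by rewrite addrC.
Qed.

Lemma convex_hull_comb3 (A : set point) a b c (r s t : R) :
  A a -> A b -> A c -> 0 <= r -> 0 <= s -> 0 <= t -> r + s + t = 1 ->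
  convex_hull A (r *: a + s *: b + t *: c).
Proof.
move=> Aa Ab Ac r0 s0 t0 rst C [cC AC].
have [rs|rs] := eqVneq (r + s) 0.
  have [-> -> ->] : [/\ r = 0, s = 0 & t = 1] by split; lra.
  by rewrite !scale0r scale1r !add0r; exact: AC.
have rs0 : 0 < r + s by rewrite lt_neqAle eq_sym rs addr_ge0.
have -> : r *: a + s *: b + t *: c =
    (1 - t) *: ((1 - s / (r + s)) *: a + (s / (r + s)) *: b) + t *: c.
  have -> : 1 - t = r + s by lra.
  by apply/rowP => i; rewrite !mxE; field.
apply: convex_set_comb => //; try exact: AC; last by lra.
apply: convex_set_comb => //; try exact: AC; first by rewrite divr_ge0 // ltW.
by rewrite ler_pdivrMr // mul1r; lra.
Qed.

Section Label.
Variables (I : finType) (E : I -> point).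
Hypothesis cE : convex_position E.

Lemma position_notin3 i j k l (r s t : R) : i != j -> i != k -> i != l ->
  0 <= r -> 0 <= s -> 0 <= t -> r + s + t = 1 ->
  E i <> r *: E j + s *: E k + t *: E l.
Proof.
move=> ij ik il r0 s0 t0 rst Ei; apply: (cE (i := i)); rewrite Ei.
have mem m : i != m -> [set E j | j in [set j | j <> i]] (E m).
  by move=> im; exists m => //= mi; rewrite mi eqxx in im.
by apply: convex_hull_comb3 => //; apply: mem.
Qed.

Lemma position_inj : injective E.
Proof.
move=> i j Eij; apply/eqP; apply: contraT => ij; exfalso.
have := @position_notin3 i j j j 1 0 0 ij ij ij.
by apply; rewrite ?addr0 // !scale0r scale1r !addr0.
Qed.

Lemma position_notin2 i j k (t : R) : i != j -> i != k -> 0 <= t -> t <= 1 ->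
  E i <> (1 - t) *: E j + t *: E k.
Proof.
move=> ij ik t0 t1; have := @position_notin3 i j j k (1 - t) 0 t ij ij ik.
by rewrite scale0r !addr0 subr_ge0; apply => //; rewrite subrK.
Qed.

Let lexle i j := (E i 0 0 < E j 0 0) || (E i 0 0 == E j 0 0) && (E i 0 1 <= E j 0 1).

Let lexle_trans : transitive lexle.
Proof.
move=> j i k /orP[ij|/andP[/eqP ij ij']] /orP[jk|/andP[/eqP jk jk']]; apply/orP.
- by left; apply: lt_trans jk.
- by left; rewrite -jk.
- by left; rewrite ij.
- by right; rewrite ij jk eqxx /=; apply: le_trans jk'.
Qed.

Let lexle_total : total lexle.
Proof. by move=> i j; rewrite /lexle; case: ltgtP => //= _; exact: le_total. Qed.

Section Pivot.
Variable o : I.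
Hypothesis omin : forall i, lexle o i.

Let X i := E i 0 0 - E o 0 0.
Let Y i := E i 0 1 - E o 0 1.

Let orientE i j : orient (E o) (E i) (E j) = X i * Y j - Y i * X j.
Proof. by rewrite /orient /X /Y; ring. Qed.

Let half i : i != o -> 0 < X i \/ X i = 0 /\ 0 < Y i.
Proof.
move=> io; have /orP[lt|/andP[/eqP e le]] := omin i; rewrite /X /Y.
  by left; rewrite subr_gt0.
right; rewrite e subrr subr_gt0 lt_neqAle le andbT; split => //.
by apply: contra io => /eqP e1; apply/eqP/position_inj/point_eq.
Qed.

(** By [half], points collinear with the pivot lie on one ray from it, and the nearer one would be
    on the segment from the pivot to the farther one. *)
Let orient_neq0 i j : i != o -> j != o -> i != j -> orient (E o) (E i) (E j) != 0.
Proof.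
move=> io jo ij; have noparallel k l (t : R) : k != o -> k != l -> 0 <= t -> t <= 1 ->
    X k = t * X l -> Y k = t * Y l -> False.
  move=> ko kl t0 t1 ex ey; apply: (position_notin2 ko kl t0 t1).
  by apply: point_eq; rewrite !mxE; move: ex ey; rewrite /X /Y; lra.
rewrite orientE; apply/eqP => /eqP; rewrite subr_eq0 => /eqP XY.
have ji : j != i by rewrite eq_sym.
case: (half io) (half jo) => [xi|[xi yi]] [xj|[xj yj]].
- case: (leP (X i) (X j)) => le.
    apply: (noparallel i j (X i / X j)) => //.
    + by rewrite divr_ge0 // ltW.
    + by rewrite ler_pdivrMr // mul1r.
    + by rewrite mulfVK // gt_eqF.
    + by rewrite mulrAC XY mulfK // gt_eqF.
  apply: (noparallel j i (X j / X i)) => //.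
  + by rewrite divr_ge0 // ltW.
  + by rewrite ler_pdivrMr // mul1r ltW.
  + by rewrite mulfVK // gt_eqF.
  + by rewrite mulrAC [X j * _]mulrC -XY [X i * _]mulrC mulfK // gt_eqF.
- by move: (mulr_gt0 xi yj); rewrite XY xj mulr0 ltxx.
- by move: (mulr_gt0 yi xj); rewrite -XY xi mul0r ltxx.
- case: (leP (Y i) (Y j)) => le.
    apply: (noparallel i j (Y i / Y j)) => //; last by rewrite mulfVK // gt_eqF.
    + by rewrite divr_ge0 // ltW.
    + by rewrite ler_pdivrMr // mul1r.
    + by rewrite xi xj mulr0.
  apply: (noparallel j i (Y j / Y i)) => //; last by rewrite mulfVK // gt_eqF.
  + by rewrite divr_ge0 // ltW.
  + by rewrite ler_pdivrMr // mul1r ltW.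
  + by rewrite xi xj mulr0.
Qed.

(** Angular order around the lexicographically least point, itself placed in front. It is transitive
    because, by [half], the other directions fill less than a half turn. *)
Let before i j := [|| i == o, i == j | (j != o) && (0 < orient (E o) (E i) (E j))].

Let before_trans : transitive before.
Proof.
move=> j i k; rewrite /before => /or3P[-> //|/eqP-> //|/andP[jo oij]].
case/or3P => [jo'|/eqP<-|/andP[ko ojk]]; first by rewrite jo' in jo.
  by rewrite jo oij !orbT.
have [//|io] := eqVneq i o; rewrite ko /=; apply/orP; right.
move: oij ojk; rewrite !orientE.
by case: (half io) (half jo) (half ko) => [xi|[xi yi]] [xj|[xj yj]] [xk|[xk yk]]; nra.
Qed.

Let before_total : total before.
Proof.
move=> i j; rewrite /before; have [//|io] := eqVneq i o; have [//|jo] := eqVneq j o.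
  by rewrite !orbT.
have [//|ij] := eqVneq i j; rewrite /=.
rewrite [orient _ (E j) _](_ : _ = - orient (E o) (E i) (E j)); last first.
  by rewrite /orient; ring.
by rewrite oppr_gt0; case: ltgtP (orient_neq0 io jo ij).
Qed.

(** Otherwise [E j] is in the triangle of [E o], [E i], [E k]: its barycentric coordinates are the
    three signed areas divided by [D]. *)
Let orient_step i j k : i != o -> j != o -> k != o ->
  i != j -> j != k -> i != k ->
  0 < orient (E o) (E i) (E j) -> 0 < orient (E o) (E j) (E k) ->
  0 < orient (E o) (E i) (E k) -> 0 < orient (E i) (E j) (E k).
Proof.
move=> io jo ko ij jk ik oij ojk oik; rewrite ltNge; apply/negP => le.
set D := orient (E o) (E i) (E k) in oik *.
have D0 : D != 0 by rewrite gt_eqF.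
have ji : j != i by rewrite eq_sym.
apply: (@position_notin3 j o i k (- orient (E i) (E j) (E k) / D)
  (orient (E o) (E j) (E k) / D) (orient (E o) (E i) (E j) / D)) => //.
- by rewrite divr_ge0 ?oppr_ge0 // ltW.
- by rewrite divr_ge0 // ltW.
- by rewrite divr_ge0 // ltW.
- by rewrite -!mulrDl; apply: (mulIf D0); rewrite mulfVK // mul1r /D /orient; ring.
- apply: (scalerI D0); rewrite !scalerDr !scalerA ![D * _]mulrC !mulfVK //.
  by apply/point_eq; rewrite !mxE /D /orient; ring.
Qed.

Lemma sorted_position : exists2 s : seq I, perm_eq s (enum I) &
  convex_curve (fun i => E (nth o s i)) #|I|.
Proof.
exists (sort before (enum I)); first by rewrite perm_sort.
set s := sort _ _; have ss : size s = #|I| by rewrite size_sort -cardE.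
have us : uniq s by rewrite sort_uniq enum_uniq.
have so : sorted before s := sort_sorted before_total _.
have bef i j : (i < j < #|I|)%N -> before (nth o s i) (nth o s j) /\ nth o s i != nth o s j.
  move=> /andP[ij jN]; have iN := ltn_trans ij jN; split.
    by apply: (sorted_ltn_nth before_trans o so) => //; rewrite inE ss.
  by rewrite nth_uniq ?ss //; move: ij; lia.
split=> [i j /bef[_ /eqP ne] /position_inj //|i j k ij jk kN].
have [b1 n1] := bef i j (ltac:(lia)); have [b2 n2] := bef j k (ltac:(lia)).
have [b3 n3] := bef i k (ltac:(lia)).
have jo : nth o s j != o.
  apply/eqP => jo; move: b1 n1; rewrite /before jo eqxx /= orbF orbb.
  by move=> ->.
have ko : nth o s k != o.
  apply/eqP => ko; move: b3 n3; rewrite /before ko eqxx /= orbF orbb.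
  by move=> ->.
have pos m l : m != l -> m != o -> before m l -> 0 < orient (E o) (E m) (E l).
  by move=> ml mo; rewrite /before (negPf ml) (negPf mo) => /andP[].
have [io|io] := eqVneq (nth o s i) o; first by rewrite io; apply: pos.
by apply: orient_step => //; apply: pos.
Qed.
End Pivot.

Lemma convex_labelling : (0 < #|I|)%N -> exists (o : I) (s : seq I),
  perm_eq s (enum I) /\ convex_curve (fun i => E (nth o s i)) #|I|.
Proof.
rewrite cardE => n0; set s := sort lexle (enum I).
have : (0 < size s)%N by rewrite size_sort.
case Es: s => [//|o s'] _.
have omin i : lexle o i.
  have : sorted lexle (o :: s') by rewrite -Es; exact: sort_sorted.
  rewrite /= => /(order_path_min lexle_trans) /allP al.
  have : i \in o :: s' by rewrite -Es mem_sort mem_enum.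
  rewrite inE => /orP[/eqP->|/al //]; by have := lexle_total o o; rewrite orbb.
by have [s1 p1 c1] := sorted_position omin; rewrite -cardE; exists o, s1.
Qed.
End Label.
End Position.

(** * Realizing paths *)

Section Lower.
Local Open Scope classical_set_scope.
Local Open Scope ring_scope.
Variable R : realType.
Local Notation point := 'rV[R]_2.
Variables (n : nat) (S : 'I_n -> point * point).

Definition same_ends (c : point * point) (P : nat -> point) (e : nat * nat) :=
  c = (P e.1, P e.2) \/ c = (P e.2, P e.1).

Definition represented F := nodes F = n /\ exists P : nat -> point, [/\ convex_curve P (2 * n),
  forall e, e \in layout 0 F -> exists j, same_ends (S j) P e &
  forall j, exists2 e, e \in layout 0 F & same_ends (S j) P e].

Lemma convex_curve_rot (P : nat -> point) N :
  convex_curve P N -> convex_curve (fun i => P (unrot N i)) N.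
Proof.
move=> PN; have last i : i.+1 == N -> unrot N i = 0%N by rewrite /unrot => ->.
have notlast i : (i.+1 < N)%N -> unrot N i = i.+1.
  by rewrite /unrot; case: eqP => // ->; rewrite ltnn.
split=> [i j /andP[ij jN]|i j k ij jk kN].
  have iN : (i.+1 < N)%N by apply: leq_ltn_trans jN.
  rewrite (notlast i iN); have [jl|jl] := eqVneq j.+1 N.
    by rewrite last ?jl // => /esym; apply: PN.1; rewrite iN.
  by rewrite notlast 1?ltn_neqAle ?jl //; apply: PN.1; rewrite ltnS ij ltn_neqAle jl.
have jN : (j.+1 < N)%N by apply: leq_ltn_trans kN.
have iN : (i.+1 < N)%N by apply: leq_ltn_trans jN; apply: leqW.
rewrite (notlast i iN) (notlast j jN); have [kl|kl] := eqVneq k.+1 N.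
  by rewrite last ?kl // orient_rot; apply: PN.2.
by rewrite notlast 1?ltn_neqAle ?kl //; apply: PN.2; rewrite // ltn_neqAle kl.
Qed.

Lemma represented_rotF F : represented F -> represented (rotF F).
Proof.
move=> [nF [P [PN P1 P2]]]; split; first by rewrite nodes_rotF.
exists (fun i => P (unrot (2 * n) i)); split; first exact: convex_curve_rot.
  have [r1 _] := layout_rotF F; move=> e /r1; rewrite nF => /orP[/P1[j Sj]|/P1[j Sj]].
    by exists j.
  by exists j; case: Sj => ->; [right|left].
have [_ r2] := layout_rotF F; move=> j; have [e /r2[d dF de] Sj] := P2 j.
exists d => //; rewrite nF in de.
case: e de Sj => e1 e2 de Sj; rewrite /same_ends.
by case: de Sj => -[-> ->] []; auto.
Qed.

Lemma represented_rotates F G : rotates F G -> represented F -> represented G.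
Proof. by move=> [i <-]; elim: i => //= i IH /IH; exact: represented_rotF. Qed.

(** The matching [m] sends the label of an endpoint to that of the other endpoint of its segment.
    Crossing labels would make two different segments meet. *)
Lemma represented_exists : (0 < n)%N -> convex_disjoint_family S ->
  exists F, represented F.
Proof.
move=> n0 [triv conv].
have cI : #|{: 'I_n * bool}| = (2 * n)%N by rewrite card_prod card_ord card_bool mulnC.
have [|o [s [ps cc]]] := convex_labelling conv; first by rewrite cI; lia.
rewrite cI in cc; set P := (fun i : nat => _) in cc.
have us : uniq s by rewrite (perm_uniq ps) enum_uniq.
have ss : size s = (2 * n)%N by rewrite (perm_size ps) -cardE.
have sm e : e \in s by rewrite (perm_mem ps) mem_enum.
pose flip (e : 'I_n * bool) := (e.1, ~~ e.2).
have flipK e : flip (flip e) = e by case: e => j b; rewrite /flip /= negbK.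
pose lab i := nth o s i; pose m i := index (flip (lab i)) s.
have labm i : lab (m i) = flip (lab i) by rewrite /lab /m nth_index.
have mlt i : (m i < 2 * n)%N by rewrite -ss index_mem.
have labI i j : (i < 2 * n)%N -> (j < 2 * n)%N -> lab i = lab j -> i = j.
  by move=> iN jN /eqP; rewrite nth_uniq ?ss // => /eqP.
have mm i : (i < 2 * n)%N -> m (m i) = i.
  by move=> iN; apply: labI => //; rewrite !labm flipK.
have ends i : S (lab i).1 = (P i, P (m i)) \/ S (lab i).1 = (P (m i), P i).
  rewrite /P -/(lab i) -/(lab (m i)) labm /flip /endpoint.
  by case: (lab i) => j [] /=; [right|left]; rewrite -surjective_pairing.
have segm i : segment (P i) (P (m i)) = fam_segment S (lab i).1.
  by rewrite /fam_segment; case: (ends i) => -> //=; rewrite segmentC.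
have [i /andP[_ iN]|i j /andP[_ iN] /andP[_ jN]|F [nF F1]] :=
    @forest_of_matching m 0 (2 * n) (leq0n _).
- split; [exact: mlt|exact: mm|move=> E].
  have := labm i; rewrite E; case: (lab i) => j b [].
  by case: b.
- apply/negP => c; have [p [pi pj]] := curve_meet cc iN (mlt i) jN (mlt j) c.
  have E : (lab i).1 = (lab j).1.
    apply: triv => //; exists p; rewrite -!segm.
    by split; apply: open_segment_sub.
  have : j = i \/ j = m i.
    have : lab j = lab i \/ lab j = flip (lab i).
      by move: E; rewrite /flip; case: (lab i) (lab j) => [k []] [l []] /= ->; auto.
    by rewrite -labm; case=> /labI; [left|right]; auto.
  case=> Ej; move: c; rewrite Ej ?mm // /cross /between /beyond /=; clear; lia.
exists F; split; first by lia.
exists P; split => [//|e /F1[_ e12 e2 me]|j].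
  by exists (lab e.1).1; rewrite /same_ends -me; exact: ends.
pose i := index (j, false) s.
have iN : (i < 2 * n)%N by rewrite -ss index_mem.
have li : lab i = (j, false) by rewrite /lab nth_index.
have ne : m i <> i by move=> E; have := labm i; rewrite E li.
have Sj := ends i; rewrite li /= in Sj.
have := ne; case: (ltngtP i (m i)) => [im|im|<- //] _.
  by exists (i, m i); [apply/F1; split; rewrite //= mlt|].
by exists (m i, i); [apply/F1; split; rewrite //= mm|case: Sj; [right|left]].
Qed.
End Lower.

Section Lower.
Local Open Scope classical_set_scope.
Local Open Scope ring_scope.
Implicit Types (e : nat * nat) (s : seq (nat * nat)).
Variable R : realType.
Local Notation point := 'rV[R]_2.
Variables (n : nat) (S : 'I_n -> point * point).

Lemma realize_alternating F s : convex_disjoint_family S -> represented S F ->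
  alternating (layout 0 F) s -> s != [::] ->
  exists p, [/\ alternating_path S p, compatible S p & num_segments S p = size s].
Proof.
move=> [triv _] [nF [P [PN P1 P2]]] sa s0; rewrite -nF in PN.
set N := (2 * nodes F)%N in PN; set M := layout 0 F in sa P1 P2.
have s0' : (0 < size s)%N by case: s s0 {sa}.
pose x i := nth 0%N (pts s) i; pose p := map P (pts s).
have sp : size p = (2 * size s)%N by rewrite size_map size_pts.
have pE i : (i < 2 * size s)%N -> p`_i = P (x i).
  by move=> lt; rewrite (nth_map 0%N) ?size_pts.
have xN i : (i < 2 * size s)%N -> (x i < N)%N.
  by move=> lt; exact: (vertex_bound sa lt).
have xI i j : (i < 2 * size s)%N -> (j < 2 * size s)%N -> i != j -> x i != x j.
  by move=> iN jN; apply: contra => /eqP /(vertex_inj sa iN jN) ->.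
have eE i : (i.+1 < 2 * size s)%N -> chain_edge p i = segment (P (x i)) (P (x i.+1)).
  by move=> lt; rewrite /chain_edge !pE //; apply: ltnW.
have fE j e : same_ends (S j) P e -> fam_segment S j = segment (P e.1) (P e.2).
  by rewrite /fam_segment; case=> -> //=; rewrite segmentC.
have MN e : e \in M -> (e.1 < N)%N /\ (e.2 < N)%N.
  by move=> /layout_bounds; rewrite /N; lia.
have edge_chord i e : (i.+1 < 2 * size s)%N -> e \in M ->
    chain_edge p i = segment (P e.1) (P e.2) ->
    (x i, x i.+1) = (e.1, e.2) \/ (x i, x i.+1) = (e.2, e.1).
  move=> lt eM; rewrite eE // => /segment_ends.
  have [e1 e2] := MN e eM.
  have x1 : (x i < N)%N by apply/xN/ltnW.
  have x2 := xN _ lt.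
  by case=> -[E1 E2]; [left|right]; congr pair; apply: (curve_inj PN).
have odd_not i j : (i.+1 < 2 * size s)%N -> odd i -> chain_edge p i <> fam_segment S j.
  move=> lt oi; have [e eM Sj] := P2 j; rewrite (fE j e Sj) => /(edge_chord _ _ lt eM) xe.
  have := odd_edge_not_chord sa lt oi; rewrite (orientedP _ _ _).2 //.
  by exists e.
have even_seg i : (i.+1 < 2 * size s)%N -> ~~ odd i -> exists j e,
    [/\ e \in M, same_ends (S j) P e, chain_edge p i = fam_segment S j &
     (x i, x i.+1) = (e.1, e.2) \/ (x i, x i.+1) = (e.2, e.1)].
  move=> lt oi; have /orientedP[e eM xe] := even_edge_oriented sa lt oi.
  have [j Sj] := P1 e eM; exists j, e; split => //.
  rewrite eE // (fE _ _ Sj) /x; case: xe => -[-> ->] //; exact: segmentC.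
have disj i j : (i.+1 < j)%N -> (j.+1 < 2 * size s)%N ->
    chain_edge p i `&` chain_edge p j = set0.
  move=> ij lt; have jl := ltnW lt.
  have il : (i.+1 < 2 * size s)%N := ltn_trans ij jl.
  have il' := ltnW il.
  rewrite !eE //; apply: (curve_disjoint PN); rewrite ?xN ?xI //;
    try by (apply/eqP; clear -ij; lia).
  by apply: (edges_cross sa) => //; exact: ltnW.
exists p; split.
- split.
    split; rewrite ?sp.
    + by clear -s0'; lia.
    + move=> i lt; have lt0 := ltnW lt; rewrite !pE //.
      move=> /(curve_inj PN (xN _ lt0) (xN _ lt)) E.
      by have := xI i i.+1 lt0 lt; rewrite E eqxx neq_ltn ltnSn => /(_ isT).
    + move=> i lt; have lt1 := ltnW lt; have lt0 := ltnW lt1.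
      rewrite !eE // pE //; apply: (curve_adjacent PN); rewrite ?xN ?xI //;
        by clear; apply/eqP; lia.
    + exact: disj.
  (* The chain starts with a segment of the family, so the even edges are the ones in [S]. *)
  exists false => i; rewrite sp => lt; split.
    by move=> [j]; case: (boolP (odd i)) => // oi /(odd_not _ _ lt oi).
  by move=> /negbT oi; have [j [e [_ _ -> _]]] := even_seg i lt oi; exists j.
- move=> j nj i; rewrite sp => lt; rewrite !pE //; last exact: ltnW.
  have [e eM Sj] := P2 j; have [e1 e2] := MN e eM.
  have lt0 := ltnW lt.
  (* A segment outside the chain has no endpoint on it: every vertex is an endpoint of a chord that
     the chain uses, and chords share no endpoints. *)
  have ej k (kn : (k < 2 * size s)%N) : x k <> e.1 /\ x k <> e.2.
    have [c [cM xc cs]] := vertex_chord sa kn; apply/not_orP => xe.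
    have ce : c = e by apply: layout_share cM eM xc xe.
    apply: nj; have : exists2 i', (i' < size s)%N &
        nth (0, 0)%N s i' = e \/ nth (0, 0)%N s i' = swap e.
      case: cs => /(nthP (0, 0)%N)[i' i's Ei]; exists i' => //; rewrite Ei ce; auto.
    case=> i' i's Ei; exists i'.*2; first by rewrite sp; clear -i's; lia.
    have lt' : (i'.*2.+1 < 2 * size s)%N by clear -i's; lia.
    rewrite eE // (fE _ _ Sj) /x; have [-> ->] := nth_pts i's.
    by case: Ei => -> //; rewrite /swap /= segmentC.
  have nc : ~~ cross e (x i, x i.+1).
    case: (boolP (odd i)) => oi; first exact: (odd_edge_cross sa lt oi eM).
    by rewrite cross_sym; apply: oriented_cross eM; exact: (even_edge_oriented sa lt oi).
  suff d0 : segment (P (x i)) (P (x i.+1)) `&` segment (P e.1) (P e.2) = set0.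
    apply/seteqP; split => // q [/open_segment_sub q1 /open_segment_sub q2].
    by rewrite -d0; split => //; rewrite -(fE _ _ Sj).
  have [/eqP n1 /eqP n2] := ej _ lt0; have [/eqP n3 /eqP n4] := ej _ lt.
  apply: (curve_disjoint PN); rewrite ?xN ?xI // 1?eq_sym //.
    by apply/eqP; clear; lia.
  by rewrite cross_sym -surjective_pairing.
- have dbl (i : 'I_(size s)) : (i.*2.+1 < 2 * size s)%N.
    by have := ltn_ord i; clear; lia.
  have /choice[J JP] : forall i : 'I_(size s), exists j,
      chain_edge p i.*2 = fam_segment S j.
    move=> i; have [|j [e [_ _ Ej _]]] := even_seg i.*2 (dbl i); last by exists j.
    by rewrite odd_double.
  have Jinj : injective J.
    move=> i i' E; apply/val_inj; have := JP i; rewrite E -(JP i').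
    case: (ltngtP i i') => // ii.
      have := disj i.*2 i'.*2; rewrite dbl => /(_ ltac:(clear -ii; lia) isT) + EE.
      by rewrite EE setIid /chain_edge => /seteqP[/(_ _ (segment_l _ _))].
    have := disj i'.*2 i.*2; rewrite dbl => /(_ ltac:(clear -ii; lia) isT) + EE.
    by rewrite EE setIid /chain_edge => /seteqP[/(_ _ (segment_l _ _))].
  rewrite /num_segments -[RHS]card_ord -(card_codom Jinj); apply: eq_card => j.
  rewrite inE; apply/asboolP/codomP => [[i]|[i ->]]; last first.
    by exists i.*2; [rewrite sp dbl|exact: JP].
  rewrite sp => lt Ei; have oi : ~~ odd i by apply/negP => oi; exact: (odd_not i j).
  have is2 : (i./2 < size s)%N by clear -lt; lia.
  exists (Ordinal is2); apply: triv => //.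
  have := JP (Ordinal is2); rewrite /= (_ : i./2.*2 = i); last by clear -oi; lia.
  by rewrite Ei => <-; rewrite setIid; exists (S j).1; exact: segment_l.
Qed.

End Lower.

Theorem lower_bound (R : realType) (n k : nat) : (max_family k.-1 < n)%N -> (0 < k)%N ->
  always_admits R n k.
Proof.
move=> kn k0 S cS; have n0 : (0 < n)%N by apply: leq_ltn_trans kn.
have [F rF] := represented_exists n0 cS.
have [|G [s [FG sk sa]]] := @exists_alternating F k; first by rewrite rF.1.
have [|p pP] := realize_alternating cS (represented_rotates FG rF) sa.
  by rewrite -size_eq0 sk -lt0n.
by exists p; rewrite -sk.
Qed.

(** * Families with only short paths *)

Section Upper.
Local Open Scope classical_set_scope.
Local Open Scope ring_scope.
Variable R : realType.
Local Notation point := 'rV[R]_2.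
Implicit Types (c d e : nat * nat) (p : seq point).

Definition parabola (x : nat) : point := \row_i (if i == 0 then x%:R else x%:R ^+ 2).

Lemma parabola0 x : parabola x 0 0 = x%:R. Proof. by rewrite mxE. Qed.
Lemma parabola1 x : parabola x 0 1 = x%:R ^+ 2. Proof. by rewrite mxE. Qed.

Lemma parabola_inj : injective parabola.
Proof.
move=> x y /rowP/(_ 0); rewrite !mxE /= => /eqP.
by rewrite eqr_nat => /eqP.
Qed.

Lemma parabola_curve N : convex_curve parabola N.
Proof.
split=> [i j /andP[ij _] /parabola_inj E|i j k ij jk _].
  by rewrite E ltnn in ij.
rewrite /orient !parabola0 !parabola1.
have {}ij : i%:R < j%:R :> R by rewrite ltr_nat.
have {}jk : j%:R < k%:R :> R by rewrite ltr_nat.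
(* The orientation is a Vandermonde determinant. *)
rewrite (_ : _ - _ = (j%:R - i%:R) * (k%:R - j%:R) * (k%:R - i%:R)); last by ring.
by rewrite !mulr_gt0 // subr_gt0 // (lt_trans ij).
Qed.

(** [C] is the open half plane above the tangent at the point with abscissa [x]; it contains all
    other points of the parabola. *)
Lemma parabola_position (I : Type) (l : I -> nat) : injective l ->
  convex_position (parabola \o l).
Proof.
move=> linj i; set x : R := (l i)%:R.
pose C : set point := [set q | 0 < q 0 1 - 2 * x * q 0 0 + x ^+ 2].
have cC : @convex_set R point C.
  apply/convex_setW => a b; rewrite !inE /C /= => a0 b0 k k0 k1.
  rewrite inE /= !mxE /unstable.onem.
  move: (k%:num) k0 k1 => t t0 t1.
  move: a0 b0; move: (a 0 0) (a 0 1) (b 0 0) (b 0 1) => a0 a1 b0 b1 A B.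
  rewrite (_ : _ + _ = t * (a1 - 2 * x * a0 + x ^+ 2) + (1 - t) * (b1 - 2 * x * b0 + x ^+ 2)).
    by rewrite addr_gt0 // mulr_gt0 // subr_gt0.
  by ring.
move=> /(_ C) /=; rewrite /C /= parabola0 parabola1 -/x => H.
suff : 0 < x ^+ 2 - 2 * x * x + x ^+ 2 by rewrite (_ : _ + _ = 0) ?ltxx //; ring.
apply: H; split => // _ [j /= ji <-]; rewrite parabola0 parabola1.
rewrite (_ : _ + _ = ((l j)%:R - x) ^+ 2); last by ring.
rewrite lt_neqAle sqr_ge0 andbT eq_sym sqrf_eq0 subr_eq0 eqr_nat.
by apply/eqP => /linj.
Qed.

Section Family.
Variables (n : nat) (F : forest).
Hypothesis nF : nodes F = n.

Definition chord (j : 'I_n) := nth (0, 0)%N (layout 0 F) j.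

Definition forest_family (j : 'I_n) : point * point :=
  (parabola (chord j).1, parabola (chord j).2).

Let S := forest_family.

Lemma chord_in j : chord j \in layout 0 F.
Proof. by apply: mem_nth; rewrite size_layout nF. Qed.

Lemma chord_inj : injective chord.
Proof.
move=> i j /eqP; rewrite nth_uniq ?size_layout ?nF ?uniq_layout //.
by move=> /eqP/val_inj.
Qed.

Lemma chord_surj e : e \in layout 0 F -> exists j, chord j = e.
Proof.
move=> /(nthP (0, 0)%N)[i]; rewrite size_layout nF => i_n <-.
by exists (Ordinal i_n).
Qed.

Lemma forest_family_disjoint : convex_disjoint_family S.
Proof.
have ch j := layout_bounds (chord_in j).
split.
  move=> i j _ _ [q [qi qj]]; apply/eqP; apply: contraT => ij; exfalso.
  have share x : x = (chord i).1 \/ x = (chord i).2 ->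
      x = (chord j).1 \/ x = (chord j).2 -> False.
    move=> xi xj; move/eqP: ij; apply; apply: chord_inj.
    exact: (layout_share (chord_in i) (chord_in j) xi xj).
  have : segment (S i).1 (S i).2 `&` segment (S j).1 (S j).2 = set0.
    have [_ [i12 i2]] := ch i; have [_ [j12 j2]] := ch j.
    rewrite add0n in i2 j2.
    apply: (curve_disjoint (@parabola_curve (2 * nodes F))) => //.
    - exact: ltn_trans i2.
    - exact: ltn_trans j2.
    - by rewrite neq_ltn i12.
    - by apply/eqP => E; apply: (share (chord i).1); [left|left; rewrite E].
    - by apply/eqP => E; apply: (share (chord i).2); [right|left; rewrite E].
    - by apply/eqP => E; apply: (share (chord i).1); [left|right; rewrite E].
    - by apply/eqP => E; apply: (share (chord i).2); [right|right; rewrite E].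
    - by rewrite -!surjective_pairing; apply: layout_cross; apply: chord_in.
  by move=> /seteqP[/(_ q (conj qi qj))].
pose l (u : 'I_n * bool) := if u.2 then (chord u.1).2 else (chord u.1).1.
have -> : endpoint S = parabola \o l.
  by apply/funext => -[j []].
apply: parabola_position => -[i b] [j c] E.
have ij : i = j.
  apply/chord_inj/(layout_share (chord_in i) (chord_in j) (x := l (i, b))).
    by rewrite /l /=; case: (b); [right|left].
  by rewrite E /l /=; case: (c); [right|left].
rewrite ij in E *; congr pair; move: E; rewrite /l /=.
by have [_ [lt _]] := ch j; case: b c => [] [] // E; move: lt; rewrite E ltnn.
Qed.

Lemma separates_cross e c d (u v : nat) : (e.1 < e.2)%N -> (c.1 < c.2)%N ->
  (d.1 < d.2)%N -> u = c.1 \/ u = c.2 -> v = d.1 \/ v = d.2 ->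
  separates e c d -> cross e (u, v).
Proof.
rewrite /separates /inside /outside /cross /between /beyond /=.
by clear; lia.
Qed.

Lemma separates_self c e : (c.1 < c.2)%N -> ~~ separates c c e /\ ~~ separates c e c.
Proof. by rewrite /separates /inside /outside; clear; lia. Qed.

(** The segments of the chain, in order, form a linkable sequence of distinct chords, to which
    [path_size] applies. A chord separating two consecutive ones would cross the link between them,
    against simplicity if the chord is in the chain and against compatibility if not. *)
Lemma chain_short p : (0 < n)%N -> alternating_path S p -> compatible S p ->
  (num_segments S p <= deg F + 2 * ht F - 2)%N.
Proof.
move=> n0 [[_ _ _ disj] [b alt]] comp; have [triv _] := forest_family_disjoint.
have /choice[J JP] : forall i, exists j, (i.+1 < size p)%N -> odd i = b ->
    chain_edge p i = fam_segment S j.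
  move=> i; have [lt|ge] := ltnP i.+1 (size p); last by exists (Ordinal n0).
  have [/(alt i lt)[j Ej]|ne] := eqVneq (odd i) b; first by exists j.
  by exists (Ordinal n0) => // _ E; rewrite E eqxx in ne.
(* The number of edges whose index has parity [b], among [(size p).-1] edges. *)
pose T := ((size p).-1 - b).+1./2.
have Tlt t : (t < T)%N = ((b + 2 * t).+1 < size p)%N.
  by rewrite /T; clear; case: b; lia.
have oddb t : odd (b + 2 * t) = b by rewrite oddD oddM /= addbF oddb.
have JE t : (t < T)%N -> chain_edge p (b + 2 * t) = fam_segment S (J (b + 2 * t)%N).
  by rewrite Tlt => lt; apply: JP.
pose s := mkseq (fun t => chord (J (b + 2 * t)%N)) T.
have ss : (num_segments S p <= size s)%N.
  rewrite size_mkseq -(size_mkseq (fun t => J (b + 2 * t)%N) T).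
  apply: leq_trans (subset_leq_card _) (card_size _); apply/fintype.subsetP => j.
  move=> /asboolP[i lt Ei].
  have oi : odd i = b by apply/(alt i lt); exists j.
  have Ei2 : (b + 2 * i./2)%N = i by rewrite -oi mul2n odd_double_half.
  apply/(nthP (Ordinal n0)); exists i./2; rewrite ?size_mkseq ?Tlt ?Ei2 //.
  rewrite nth_mkseq ?Tlt ?Ei2 //; apply: triv => //.
  by rewrite -JP // Ei setIid; exists (S j).1; exact: segment_l.
apply: leq_trans ss _.
have ends t : (t < T)%N -> let c := chord (J (b + 2 * t)%N) in
    (p`_(b + 2 * t) = parabola c.1 \/ p`_(b + 2 * t) = parabola c.2) /\
    (p`_(b + 2 * t).+1 = parabola c.1 \/ p`_(b + 2 * t).+1 = parabola c.2).
  by move=> /JE /segment_ends[] [-> ->]; auto.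
apply: (@path_size (layout 0 F) 0) => //.
- apply/(mkseq_uniqP _ T) => t t'; rewrite !inE => tT tT' /chord_inj EJ.
  wlog lt : t t' tT tT' EJ / (t < t')%N => [H|].
    case: (ltngtP t t') => // lt; first exact: H.
    by apply/esym/H.
  exfalso; have := disj (b + 2 * t)%N (b + 2 * t')%N.
  move=> /(_ ltac:(clear -lt; lia)); rewrite -Tlt => /(_ tT').
  rewrite JE // JE // EJ setIid => /seteqP[/(_ _ (segment_l _ _))].
  by [].
- by move=> c /mapP[t _ ->]; exact: chord_in.
- apply/(sortedP (0, 0)%N) => t; rewrite size_mkseq => tT.
  have tT0 : (t < T)%N := ltnW tT.
  rewrite !nth_mkseq //; set c := chord _; set d := chord _.
  have [_ ecs] := ends t tT0; have [eds _] := ends t.+1 tT.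
  rewrite -/c -/d in ecs eds.
  have Enext : (b + 2 * t.+1 = (b + 2 * t).+2)%N by clear; lia.
  apply/allP => e eF; apply/negP => sep.
  have [j Ej] := chord_surj eF.
  have [u uc pu] : exists2 u, u = c.1 \/ u = c.2 & p`_(b + 2 * t).+1 = parabola u.
    by case: ecs => ->; [exists c.1|exists c.2]; auto.
  have [v vd pv] : exists2 v, v = d.1 \/ v = d.2 & p`_(b + 2 * t).+2 = parabola v.
    by rewrite -Enext; case: eds => ->; [exists d.1|exists d.2]; auto.
  have eb := layout_bounds eF.
  have cb := layout_bounds (chord_in (J (b + 2 * t)%N)); rewrite -/c in cb.
  have db := layout_bounds (chord_in (J (b + 2 * t.+1)%N)); rewrite -/d in db.
  have cr := separates_cross eb.2.1 cb.2.1 db.2.1 uc vd sep.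
  have lt3 : ((b + 2 * t).+2 < size p)%N by rewrite -Enext ltnW // -Tlt.
  have [q [qe qo]] : open_segment (S j).1 (S j).2 `&`
      open_segment p`_(b + 2 * t).+1 p`_(b + 2 * t).+2 !=set0.
    rewrite pu pv /S /forest_family Ej.
    apply: (curve_meet (@parabola_curve (2 * nodes F))); last by rewrite -surjective_pairing.
    - by clear -eb; lia.
    - by clear -eb; lia.
    - by clear -uc cb; lia.
    - by clear -vd db; lia.
  have [[i'' lt'' Ei]|nin] := pselect (in_chain S p j); last first.
    by have := comp j nin _ lt3 => /seteqP[/(_ q (conj qo qe))].
  have o'' : odd i'' = b by apply/(alt _ lt''); exists j.
  have /(open_segment_sub) qj := qe; have /(open_segment_sub) qc := qo.
  have same k : (k < T)%N -> i'' = (b + 2 * k)%N -> e = chord (J (b + 2 * k)%N).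
    move=> kT Ek; rewrite -Ej; congr chord; apply: triv => //.
    by rewrite -Ei Ek JE // setIid; exists (S (J (b + 2 * k)%N)).1; exact: segment_l.
  have [Ec|nc] := eqVneq i'' (b + 2 * t)%N.
    have Eec : e = c := same t tT0 Ec.
    by move: sep; rewrite Eec (negPf (separates_self d cb.2.1).1).
  have [Ed|nd] := eqVneq i'' (b + 2 * t.+1)%N.
    have Eed : e = d := same t.+1 tT Ed.
    by move: sep; rewrite Eed (negPf (separates_self c db.2.1).2).
  have qi : chain_edge p i'' q by rewrite Ei.
  (* By parity, an edge in [S] that is neither end of the link is not adjacent to it, so the two
     must be disjoint. *)
  have [lt|gt] : (i''.+1 < (b + 2 * t).+1)%N \/ ((b + 2 * t).+2 < i'')%N.
    have par : odd (b + 2 * t) = odd i'' by rewrite oddb o''.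
    have : i'' != (b + 2 * t).+1 by apply/eqP => E; move: par; rewrite E; clear; lia.
    by move: nc nd; rewrite Enext; clear; lia.
  + by have := disj i'' (b + 2 * t).+1 lt lt3 => /seteqP[/(_ q (conj qi qc))].
  + by have := disj (b + 2 * t).+1 i'' gt lt'' => /seteqP[/(_ q (conj qc qi))].
Qed.
End Family.
End Upper.

Theorem upper_bound (R : realType) (n k k' : nat) : (0 < n <= max_family k)%N ->
  always_admits R n k' -> (k' <= k)%N.
Proof.
move=> /andP[n0 nk]; have [F [nF short]] := exists_short_forest nk.
move=> /(_ _ (forest_family_disjoint R nF))[p [pa pc <-]].
apply: leq_trans short; rewrite leq_min (chain_short nF n0 pa pc) andbT.
by rewrite /num_segments; apply: leq_trans (max_card _) _; rewrite card_ord.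
Qed.

Lemma q_is_max_family (R : realType) n k :
  max_family k.-1 < n <= max_family k -> q_is R n k.
Proof.
move=> /andP[lt le]; have n0 : 0 < n by apply: leq_ltn_trans lt.
split=> [|k']; last by apply: upper_bound; rewrite n0.
by apply: lower_bound => //; case: k lt le => // n0'; rewrite leqNgt n0.
Qed.

Local Open Scope ring_scope.

Theorem theorem2 (R : realType) :
  (forall n : nat, (1 <= n <= 4)%N -> q_is R n n) /\
  (forall n : nat, (5 <= n <= 6)%N -> q_is R n 5) /\
  (forall n : nat, (7 <= n <= 8)%N -> q_is R n 6) /\
  (forall n : nat, (9 <= n <= 10)%N -> q_is R n 7) /\
  (forall n : nat, (11 <= n <= 12)%N -> q_is R n 8) /\
  (forall n : nat, (13 <= n <= 15)%N -> q_is R n 9) /\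
  (forall n : nat, (16 <= n <= 20)%N -> q_is R n 10) /\
  (forall n : nat, (21 <= n <= 25)%N -> q_is R n 11) /\
  (forall n : nat, (26 <= n <= 30)%N -> q_is R n 12) /\
  (forall n : nat, (31 <= n <= 35)%N -> q_is R n 13) /\
  (forall n : nat, (36 <= n <= 44)%N -> q_is R n 14) /\
  (forall n : nat, (45 <= n <= 55)%N -> q_is R n 15) /\
  (forall n : nat, (56 <= n <= 66)%N -> q_is R n 16) /\
  (forall n : nat, (67 <= n <= 80)%N -> q_is R n 17) /\
  (forall n : nat, (81 <= n <= 96)%N -> q_is R n 18) /\
  (forall n : nat, (97 <= n <= 115)%N -> q_is R n 19) /\
  (forall n : nat, (116 <= n <= 138)%N -> q_is R n 20) /\
  (forall n : nat, (139 <= n <= 170)%N -> q_is R n 21) /\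
  (forall n : nat, (171 <= n)%N ->
     exists2 k : nat, q_is R n k &
       k%:Z = Num.max (q0 R n) (Num.max (q1 R n) (Num.max (q2 R n)
                (Num.max (q3 R n) (Num.max (q4 R n) (q5 R n)))))).
Proof.
(* The bounds in the table are consecutive values of [max_family]. *)
have q lo hi k n : (max_family k.-1 == lo) && (max_family k == hi) ->
    (lo < n <= hi)%N -> q_is R n k.
  by move=> /andP[/eqP<- /eqP<-]; exact: q_is_max_family.
split.
  move=> [|[|[|[|[|n]]]]] // _; [exact: (q 0 1)%N|exact: (q 1 2)%N|exact: (q 2 3)%N|].
  exact: (q 3 4)%N.
split; first by move=> n; apply: (q 4 6)%N.
split; first by move=> n; apply: (q 6 8)%N.
split; first by move=> n; apply: (q 8 10)%N.
split; first by move=> n; apply: (q 10 12)%N.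
split; first by move=> n; apply: (q 12 15)%N.
split; first by move=> n; apply: (q 15 20)%N.
split; first by move=> n; apply: (q 20 25)%N.
split; first by move=> n; apply: (q 25 30)%N.
split; first by move=> n; apply: (q 30 35)%N.
split; first by move=> n; apply: (q 35 44)%N.
split; first by move=> n; apply: (q 44 55)%N.
split; first by move=> n; apply: (q 55 66)%N.
split; first by move=> n; apply: (q 66 80)%N.
split; first by move=> n; apply: (q 80 96)%N.
split; first by move=> n; apply: (q 96 115)%N.
split; first by move=> n; apply: (q 115 138)%N.
split; first by move=> n; apply: (q 138 170)%N.
move=> n n171.
(* The value is the least such [k]; one exists since [k <= max_family k]. *)
have ex : exists k, (n <= max_family k)%N by exists n; rewrite leq_maxl.
case: (ex_minnP ex) => k kn kmin.
have nk : (max_family k.-1 < n)%N.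
  rewrite ltnNge; apply/negP => /kmin; case: k kn {kmin} => [|k _] /=; last by rewrite ltnn.
  by move=> /(leq_trans n171).
exists k; first by apply: q_is_max_family; rewrite nk.
by apply: q_formula; rewrite // nk.
Qed.
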